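(* Let $d\ge3$, $0\leq\alpha<d$, $1\leq p<d/\alpha$ (with $d/\alpha=\infty$ if $\alpha=0$), $1/q=1/p-\alpha/d$, and let $\rho$ be a critical radius function on $\mathbb{R}^d$. Let $\mu,\nu$ be weights on $\mathbb{R}^d$ such that $\mu\nu^{-q/p'}\in A_1^\rho(\mathbb{R}^d)$ and $\nu^q\in A_\infty^\rho(\mu\nu^{-q/p'})$. Then there exist $\theta\geq 0$ and a constant $C>0$ such that for every $t>0$ and every $f\in L_c^\infty(\mathbb{R}^d)$, $$\mu\nu^{q/p}\Big(\Big\{x\in\mathbb{R}^d:\frac{M_\alpha^{\rho,\theta}(f\nu)(x)}{\nu(x)}>t\Big\}\Big)^{1/q}\leq\frac{C}{t}\Big(\int_{\mathbb{R}^d}|f(x)|^p\mu(x)^{p/q}\nu(x)\,dx\Big)^{1/p}.$$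
   Context: A critical radius function is a function $\rho:\mathbb{R}^d\to(0,\infty)$ for which there are positive constants $C_0,N_0$ such that for all $x,y\in\mathbb{R}^d$, $$C_0^{-1}\rho(x)\Big(1+\frac{|x-y|}{\rho(x)}\Big)^{-N_0}\leq\rho(y)\leq C_0\rho(x)\Big(1+\frac{|x-y|}{\rho(x)}\Big)^{\frac{N_0}{N_0+1}}.$$ A cube is written $Q=Q(x_Q,r_Q)$ with center $x_Q$ and side-length $r_Q$; for $\theta\ge0$, $\psi_\theta(Q)=(1+r_Q/\rho(x_Q))^\theta$. The fractional maximal function is $$M_\alpha^{\rho,\theta}f(x)=\sup_{Q\ni x}\frac{1}{\psi_\theta(Q)|Q|^{1-\frac{\alpha}{d}}}\int_Q|f(y)|\,dy.$$ $p'$ is the conjugate exponent of $p$; if $p=1$ then $p'=\infty$ and $q/p'=0$. A weight is a locally integrable function $\omega$ on $\mathbb{R}^d$ with $0<\omega<\infty$ a.e. For a weight $w$ and a measurable set $E$, $w(E)=\int_E w(x)\,dx$. In particular $\mu\nu^{q/p}(E)=\int_E\mu\nu^{q/p}\,dx$. $L_c^\infty(\mathbb{R}^d)$ is the space of bounded measurable functions with compact support. For a weight $\mu_0$, $\theta\ge 0$ and $1<s<\infty$, $\omega\in A_s^{\rho,\theta}(\mu_0)$ means $$\sup_{Q}\Big(\frac{1}{\psi_\theta(Q)\mu_0(Q)}\int_{Q}\omega\,\mu_0\,dx\Big)\Big(\frac{1}{\psi_\theta(Q)\mu_0(Q)}\int_{Q}\omega^{1-s'}\mu_0\,dx\Big)^{s-1}<\infty,$$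 and $\omega\in A_1^{\rho,\theta}(\mu_0)$ means $$\sup_{Q}\Big(\frac{1}{\psi_\theta(Q)\mu_0(Q)}\int_{Q}\omega\,\mu_0\,dx\Big)\|\omega^{-1}\|_{L^\infty(Q)}<\infty,$$ the suprema being over all cubes $Q\subset\mathbb{R}^d$. Set $A_s^\rho(\mu_0)=\bigcup_{\theta\geq0}A_s^{\rho,\theta}(\mu_0)$ for $1\le s<\infty$ and $A_\infty^\rho(\mu_0)=\bigcup_{s\geq1}A_s^\rho(\mu_0)$. When $\mu_0=1$, write $A_s^\rho(\mathbb{R}^d)$. *)

(* Defs.v *)
From HB Require Import structures.
From mathcomp Require Import all_boot all_order all_algebra.
From mathcomp Require Import all_classical all_reals all_analysis.
From mathcomp Require Import measurable_realfun.

Set Implicit Arguments.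
Unset Strict Implicit.
Unset Printing Implicit Defensive.

Import Order.TTheory GRing.Theory Num.Theory.
Import numFieldNormedType.Exports.

Local Open Scope classical_set_scope.
Local Open Scope ring_scope.
Local Open Scope ereal_scope.

(* Lebesgue measure on 'rV[R]_d: the Caratheodory measure of the outer measure
   obtained from at most countable coverings by half-open boxes. *)

Definition box (R : realType) (d : nat) (a b : 'rV[R]_d) : set 'rV[R]_d :=
  [set x | forall i, (a ord0 i < x ord0 i <= b ord0 i)%R].

Definition box_vol (R : realType) (d : nat) (a b : 'rV[R]_d) : R :=
  (\prod_(i < d) Num.max 0 (b ord0 i - a ord0 i))%R.

(* The index set S makes the empty covering available; it matters only for
   d = 0, where no box is empty. *)
Definition lebesgue_outer (R : realType) (d : nat) (A : set 'rV[R]_d) : \bar R :=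
  ereal_inf [set v | exists (S : set nat) (a b : nat -> 'rV[R]_d),
    A `<=` \bigcup_(k in S) box (a k) (b k) /\
    v = \esum_(k in S) (box_vol (a k) (b k))%:E].

Section lebesgue_outer_measure.
Variables (R : realType) (d : nat).
Implicit Types A B : set 'rV[R]_d.

Let vol_ge0 (a b : 'rV[R]_d) : 0 <= (box_vol a b)%:E.
Proof.
by rewrite lee_fin; apply: prodr_ge0 => i _; rewrite le_max lexx.
Qed.

Lemma lebesgue_outer_ge0 A : 0 <= lebesgue_outer A.
Proof.
apply: le_ereal_inf_tmp => x [S [a [b [_ ->]]]].
by apply: esum_ge0 => k _; exact: vol_ge0.
Qed.

Lemma lebesgue_outer0 : lebesgue_outer (@set0 'rV[R]_d) = 0.
Proof.
apply/eqP; rewrite eq_le lebesgue_outer_ge0 andbT.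
apply: ereal_inf_lbound; exists set0, (fun=> 0%R), (fun=> 0%R); split => //.
by rewrite esum_set0.
Qed.

Lemma le_lebesgue_outer A B : A `<=` B -> lebesgue_outer A <= lebesgue_outer B.
Proof.
move=> AB; apply: ereal_inf_le_tmp => v [S [a [b [BS ->]]]].
by exists S, a, b; split => //; exact: subset_trans BS.
Qed.

Lemma lebesgue_outer_sigma_subadditive :
  sigma_subadditive (@lebesgue_outer R d).
Proof.
move=> A; have [[i ioo]|] := pselect (exists i, lebesgue_outer (A i) = +oo).
  rewrite (eseries_pinfty _ _ ioo) ?leey// => n _.
  by rewrite -ltNye (lt_le_trans _ (lebesgue_outer_ge0 _)).
rewrite -forallNE => Aoo.
suff add2e (e : {posnum R}) : lebesgue_outer (\bigcup_n A n) <=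
    \sum_(i <oo) lebesgue_outer (A i) + e%:num%:E.
  by apply/lee_addgt0Pr => _/posnumP[].
rewrite (le_trans _ (epsilon_trick _ _ _))//; last first.
  by move=> n; exact: lebesgue_outer_ge0.
pose P n (c : set nat * ((nat -> 'rV[R]_d) * (nat -> 'rV[R]_d))) :=
  A n `<=` \bigcup_(k in c.1) box (c.2.1 k) (c.2.2 k) /\
  \esum_(k in c.1) (box_vol (c.2.1 k) (c.2.2 k))%:E <=
    lebesgue_outer (A n) + (e%:num / (2 ^ n.+1)%:R)%:E.
have [G PG] : {G : nat -> _ & forall n, P n (G n)}.
  apply: (@choice _ _ P) => n; rewrite /P.
  have en1 : (0 < e%:num / (2 ^ n.+1)%:R :> R)%R by [].
  have fA : lebesgue_outer (A n) \is a fin_num.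
    rewrite ge0_fin_numE ?lebesgue_outer_ge0// ltey; exact/eqP/Aoo.
  have [x [S [a [b [AS xE]]]] xlt] := lb_ereal_inf_adherent en1 fA.
  by exists (S, (a, b)); split => //=; rewrite -xE; exact: ltW.
apply: (@le_trans _ _ (\esum_(n in [set: nat])
    \esum_(k in (G n).1) (box_vol ((G n).2.1 k) ((G n).2.2 k))%:E)); last first.
  rewrite -nneseries_esumT; last first.
    by move=> n; apply: esum_ge0 => k _; exact: vol_ge0.
  apply: lee_nneseries => n _; last exact: (PG n).2.
  by move=> _; apply: esum_ge0 => k _; exact: vol_ge0.
rewrite esum_esum; last by move=> *; exact: vol_ge0.
have /card_esym/ppcard_eqP[f] := card_nat2.
set K := (X in \esum_(_ in X) _).
apply: ereal_inf_lbound; exists (f @^-1` K),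
  (fun m => (G (f m).1).2.1 (f m).2), (fun m => (G (f m).1).2.2 (f m).2).
split.
- move=> x [n _ /(PG n).1[k Sk xk]]; exists (f^-1%FUN (n, k)) => /=.
    by rewrite invK ?inE.
  by rewrite invK ?inE.
- apply: (@reindex_esum _ _ _ _ _ f
    (fun z => (box_vol ((G z.1).2.1 z.2) ((G z.1).2.2 z.2))%:E)).
  have [g fK gK] : bijective f by exact: bijTT.
  split.
  + by move=> m.
  + by move=> x y _ _; exact: (can_inj fK).
  + by move=> z Kz; exists (g z) => //=; rewrite gK.
Qed.

HB.instance Definition _ := isOuterMeasure.Build R 'rV[R]_d (@lebesgue_outer R d)
  lebesgue_outer0 lebesgue_outer_ge0 le_lebesgue_outer
  lebesgue_outer_sigma_subadditive.

End lebesgue_outer_measure.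

(* The measurable sets of 'rV[R]_d are the Lebesgue measurable ones. *)
HB.instance Definition _ (R : realType) (d : nat) :=
  Measurable.copy 'rV[R]_d (caratheodory_type (@lebesgue_outer R d)).

Definition leb (R : realType) (d : nat) : {measure set 'rV[R]_d -> \bar R} :=
  let mu : {outer_measure set 'rV[R]_d -> \bar R} := @lebesgue_outer R d in
  (mu : {measure set (caratheodory_type mu) -> \bar R}).
Arguments leb {R d}.

(* The library's norm on 'rV[R]_d is the sup norm. *)
Definition enorm (R : realType) (d : nat) (x : 'rV[R]_d) : R :=
  Num.sqrt (\sum_(i < d) x ord0 i ^+ 2)%R.

Definition critical_radius (R : realType) (d : nat) (rho : 'rV[R]_d -> R) : Prop :=
  (forall x, 0 < rho x)%R /\
  exists C0 N0 : R, [/\ (0 < C0)%R, (0 < N0)%R &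
    forall x y,
      (C0^-1 * rho x * (1 + enorm (x - y) / rho x) `^ (- N0) <= rho y)%R /\
      (rho y <= C0 * rho x * (1 + enorm (x - y) / rho x) `^ (N0 / (N0 + 1)))%R].

(* Cubes have sides parallel to the coordinate axes. *)
Definition cube (R : realType) (d : nat) (c : 'rV[R]_d) (r : R) : set 'rV[R]_d :=
  [set x | forall i, (`|x ord0 i - c ord0 i| <= r / 2)%R].

Definition psi (R : realType) (d : nat) (rho : 'rV[R]_d -> R) (theta : R)
    (c : 'rV[R]_d) (r : R) : R :=
  ((1 + r / rho c) `^ theta)%R.

Definition frac_maximal (R : realType) (d : nat) (rho : 'rV[R]_d -> R)
    (theta alpha : R) (f : 'rV[R]_d -> \bar R) (x : 'rV[R]_d) : \bar R :=
  ereal_sup [set v | exists (c : 'rV[R]_d) (r : R),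
    [/\ (0 < r)%R, cube c r x &
     v = ((psi rho theta c r)%:E *
            leb (cube c r) `^ (1 - alpha / d%:R)%R)^-1 *
         \int[leb]_(y in cube c r) `|f y|]].

Definition weight (R : realType) (d : nat) (w : 'rV[R]_d -> \bar R) : Prop :=
  [/\ measurable_fun setT w,
      forall K : set 'rV[R]_d, compact K -> \int[leb]_(x in K) `|w x| < +oo &
      {ae leb, forall x, 0 < w x < +oo}].

Definition wmeasure (R : realType) (d : nat) (w : 'rV[R]_d -> \bar R)
    (E : set 'rV[R]_d) : \bar R :=
  \int[leb]_(x in E) w x.

Definition conj_exp (R : realType) (s : R) : R :=
  fine (hoelder_conjugate s%:E).

(* The quantity whose supremum over all cubes has to be finite for w to be in
   A_s^{rho,theta}(mu0), for s >= 1. *)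
Definition A_quantity (R : realType) (d : nat) (rho : 'rV[R]_d -> R) (theta : R)
    (mu0 : 'rV[R]_d -> \bar R) (s : R) (w : 'rV[R]_d -> \bar R)
    (c : 'rV[R]_d) (r : R) : \bar R :=
  let avg (g : 'rV[R]_d -> \bar R) :=
    ((psi rho theta c r)%:E * wmeasure mu0 (cube c r))^-1 *
    \int[leb]_(x in cube c r) (g x * mu0 x) in
  if s == 1%R then
    avg w * 'N[leb]_(+oo)[(fun x => (w x)^-1) \_ (cube c r)]
  else
    avg w * (avg (fun x => w x `^ (1 - conj_exp s)%R)) `^ (s - 1)%R.

Definition A_class_theta (R : realType) (d : nat) (rho : 'rV[R]_d -> R)
    (theta : R) (mu0 : 'rV[R]_d -> \bar R) (s : R) (w : 'rV[R]_d -> \bar R) :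
    Prop :=
  ereal_sup [set v | exists (c : 'rV[R]_d) (r : R),
    (0 < r)%R /\ v = A_quantity rho theta mu0 s w c r] < +oo.

Definition A_class (R : realType) (d : nat) (rho : 'rV[R]_d -> R)
    (mu0 : 'rV[R]_d -> \bar R) (s : R) (w : 'rV[R]_d -> \bar R) : Prop :=
  exists2 theta : R, (0 <= theta)%R & A_class_theta rho theta mu0 s w.

Definition A_infty (R : realType) (d : nat) (rho : 'rV[R]_d -> R)
    (mu0 : 'rV[R]_d -> \bar R) (w : 'rV[R]_d -> \bar R) : Prop :=
  exists2 s : R, (1 <= s)%R & A_class rho mu0 s w.

Definition Linfty_c (R : realType) (d : nat) (f : 'rV[R]_d -> R) : Prop :=
  [/\ measurable_fun setT f,
      exists M : R, forall x, (`|f x| <= M)%R &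
      compact (closure [set x | f x != 0%R])].

(* q / p', which is 0 when p = 1 since then p' = +oo. *)
Definition div_conj (R : realType) (q p : R) : R :=
  fine (q%:E / hoelder_conjugate p%:E).

(* Main.v *)
(* Put m = mu nu^(-q/p') and v = nu^q. By Hoelder's inequality and m in A_1, a
   point x of the level set lies in a cube Q with psi(Q) m(Q) v(x) < G(Q), where
   G has density const |f nu|^p m^(p/q); the power q/p on G(Q) is removed by
   G(Q)^(q/p) <= G(R^d)^(q/p - 1) G(Q). It remains to bound the V-measure of
   these points by C G(R^d), where dV = v dm.
   Let v be in A_s(m) with s > 1, u = 1/(s - 1) and dW = v^(-u) dm. Up to powers
   of psi, which a large theta absorbs, V and W are doubling. Let N be the maximal
   function of G relative to V; N > 1 only on a set of V-measure <= C G(R^d). If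
   N(x) <= 1, the A_s condition turns psi(Q) m(Q) v(x) < G(Q) into
   v(x)^u W(Q) <= C int_Q min(N, 1)^u dm, that is, with h = min(N, 1)^u, the
   maximal function of h v^u relative to W is at least v(x)^u / C. Its weak type
   (1,1) estimate on each dyadic level set of v, summed over the levels, gives the
   bound C int h^s v dm = C int min(N, 1)^(s/(s - 1)) dV <= C G(R^d).
   Both weak type bounds come from Vitali's covering lemma, in the form: if
   A(5 Q) <= B(Q) for all Q in a family of cubes, then A(union of the family) is
   at most B(R^d). *)

Require Import Defs.
From mathcomp Require Import all_boot all_order all_algebra.
From mathcomp Require Import all_classical all_reals all_analysis.
From mathcomp Require Import measurable_realfun ess_sup_inf.
From mathcomp Require Import ring lra.

Set Implicit Arguments.
Unset Strict Implicit.
Unset Printing Implicit Defensive.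

Import Order.TTheory GRing.Theory Num.Theory.
Import numFieldNormedType.Exports.

Local Open Scope classical_set_scope.
Local Open Scope ring_scope.
Local Open Scope ereal_scope.

(** * Nonnegative integrals and Lebesgue measure of cubes *)

(** The level condition compares [v] at a single point with quantities averaged over [Q], so
    covering relative to V does not apply to it directly. The A_s condition trades V(Q) for W(Q),
    and as dm = v^u dW the right-hand side becomes a W-average, that of h v^u, to be compared with
    v(x)^u. Where v^u is about l, V is about l^s W (from s u - u = 1), so the weak type bound at
    height l contributes l^(s - 1) times the integral of h dm over {h v^u > c l}; summed over dyadic
    l this gives h^s v dm. The truncation of N at 1 is forced by h^s = min(N, 1)^(1 + u): its
    V-integral is a sum of terms l^(1 + u) V(N > l) <= C l^u G(R^d), which converges for small l
    only. Neither N nor the maximal function relative to W is ever formed. Measurable sets produced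
    by the covering lemma stand in for their level sets, and the quotient of one cube replaces N,
    which suffices because the whole cube lies in the covering set. A cut-off 2^-n keeps the dyadic
    sums finite; it is removed at the end, the constants being independent of n. *)

Section nonnegative_integrals.
Context d (T : measurableType d) (R : realType).
Variable mu : {measure set T -> \bar R}.
Implicit Types (E F : set T) (a b : T -> \bar R).

Lemma ge0_integral_setU_le E F a : measurable E -> measurable F ->
  measurable_fun setT a -> (forall x, 0 <= a x) ->
  \int[mu]_(x in E `|` F) a x <= \int[mu]_(x in E) a x + \int[mu]_(x in F) a x.
Proof.
move=> mE mF ma a0; rewrite (_ : E `|` F = E `|` (F `\` E)); last first.
  apply/seteqP; split => x; last by move=> [|[]]; [left|right].
  by move=> [|Fx]; [left|have [|nEx] := pselect (E x); [left|right]].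
have mFE : measurable (F `\` E) by exact: measurableD.
rewrite ge0_integral_setU//.
- apply: leeD => //; apply: ge0_subset_integral => //.
  exact: measurable_funTS.
- exact: measurable_funTS.
- by rewrite disj_set2E setDIK.
Qed.

Lemma ge0_integral_bigsetU_le (I : Type) (s : seq I) (P : pred I) (E : I -> set T) a :
  (forall i, measurable (E i)) -> measurable_fun setT a -> (forall x, 0 <= a x) ->
  \int[mu]_(x in \big[setU/set0]_(i <- s | P i) E i) a x
    <= \sum_(i <- s | P i) \int[mu]_(x in E i) a x.
Proof.
move=> mE ma a0; elim: s => [|i s ih]; first by rewrite !big_nil integral_set0.
rewrite !big_cons; case: ifPn => // _.
apply: le_trans (leeD2l _ ih); apply: ge0_integral_setU_le => //.
exact: bigsetU_measurable.
Qed.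

Lemma ge0_nondecreasing_integral_le (F : (set T)^nat) a M :
  nondecreasing_seq F -> (forall n, measurable (F n)) ->
  measurable_fun setT a -> (forall x, 0 <= a x) ->
  (forall n, \int[mu]_(x in F n) a x <= M) ->
  \int[mu]_(x in \bigcup_n F n) a x <= M.
Proof.
move=> ndF mF ma a0 FM.
have cF := @ge0_nondecreasing_set_cvg_integral _ _ _ F a mu ndF mF
  (fun i => measurable_funTS ma) (fun i x _ => a0 x).
rewrite -(cvg_lim _ cF)//; apply: lime_le; first by apply/cvg_ex; eexists; exact: cF.
exact: nearW.
Qed.

(** [F] need not be nested, so [G] is its lower limit: [E n] lies in every [F m] with m >= n because
    [E] increases, and the tail intersections increase with integrals at most [M]. This later
    removes the cut-off 2^-n. *)
Lemma ge0_integral_cover_limit (E F : (set T)^nat) a M :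
  nondecreasing_seq E -> (forall n, E n `<=` F n) ->
  (forall n, measurable (F n)) ->
  measurable_fun setT a -> (forall x, 0 <= a x) ->
  (forall n, \int[mu]_(x in F n) a x <= M) ->
  exists G, [/\ measurable G, \bigcup_n E n `<=` G & \int[mu]_(x in G) a x <= M].
Proof.
move=> ndE EF mF ma a0 FM.
pose G n := \bigcap_(m in [set m | (n <= m)%N]) F m.
have mG n : measurable (G n) by apply: bigcap_measurable; [exists n => /=|].
exists (\bigcup_n G n); split.
- exact: bigcup_measurable.
- move=> x [n _ Enx]; exists n => // m /= nm; apply: EF.
  by move: x Enx; apply/subsetPset; exact: ndE.
- apply: ge0_nondecreasing_integral_le => //.
  + move=> n m nm; apply/subsetPset => x Gx k /= mk; apply: Gx => /=.
    exact: leq_trans mk.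
  + move=> n; apply: le_trans (FM n); apply: ge0_subset_integral => //.
      exact: measurable_funTS.
    by move=> x /(_ n) /=; apply.
Qed.

End nonnegative_integrals.

Section lebesgue_boxes.
Context (R : realType) (d : nat).
Local Notation V := 'rV[R]_d.
Implicit Types (a b c x : V) (i : 'I_d).

Definition set_coord x i (t : R) : V := (\row_j if j == i then t else x ord0 j)%R.

Lemma box_vol_ge0 a b : (0 <= box_vol a b)%R.
Proof. by apply: prodr_ge0 => i _; rewrite le_max lexx. Qed.

Lemma set_coordE x i t j : set_coord x i t ord0 j = if j == i then t else x ord0 j.
Proof. by rewrite mxE. Qed.

Lemma box_vol_split a b i (t : R) :
  (box_vol a (set_coord b i (Num.min (b ord0 i) t)) +
   box_vol (set_coord a i (Num.max (a ord0 i) t)) b = box_vol a b)%R.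
Proof.
rewrite /box_vol (bigD1 i)//= [X in (_ + X)%R](bigD1 i)//= [RHS](bigD1 i)//=.
rewrite !set_coordE eqxx.
under eq_bigr => j ji do rewrite set_coordE (negbTE ji).
under [X in (_ + _ * X)%R]eq_bigr => j ji do rewrite set_coordE (negbTE ji).
rewrite -mulrDl; congr (_ * _)%R.
rewrite /Num.max /Num.min.
by do ! case: ifPn; lra.
Qed.

(** Every covering of [X] is cut along the hyperplane x_i = t into coverings of the two halves with
    the same total volume. Half-open boxes make the cut exact: both pieces are again half-open. *)
Lemma measurable_le_coord i (t : R) : measurable [set x : V | (x ord0 i <= t)%R].
Proof.
apply: (@le_caratheodory_measurable R V (@lebesgue_outer R d)) => X.
set H := [set x : V | _].
apply: le_ereal_inf_tmp => _ [S [a [b [XS ->]]]].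
have vol0 (a' b' : nat -> V) k : 0 <= (box_vol (a' k) (b' k))%:E by rewrite lee_fin box_vol_ge0.
pose b' k := set_coord (b k) i (Num.min (b k ord0 i) t).
pose a' k := set_coord (a k) i (Num.max (a k ord0 i) t).
have XH : lebesgue_outer (X `&` H) <= \esum_(k in S) (box_vol (a k) (b' k))%:E.
  apply: ereal_inf_lbound; exists S, a, b'; split => // x [/XS[k Sk xk] Hx].
  exists k => // j; rewrite set_coordE; case: eqP => [->|_]; last exact: xk.
  by have /andP[-> xb] := xk i; rewrite le_min xb.
have XHC : lebesgue_outer (X `&` ~` H) <= \esum_(k in S) (box_vol (a' k) (b k))%:E.
  apply: ereal_inf_lbound; exists S, a', b; split => // x [/XS[k Sk xk] Hx].
  exists k => // j; rewrite set_coordE; case: eqP => [->|_]; last exact: xk.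
  have /andP[ax ->] := xk i; rewrite gt_max ax/= andbT.
  by rewrite ltNge; apply/negP.
apply: le_trans (leeD XH XHC) _.
rewrite -esumD//; try by move=> *; exact: vol0.
by under eq_esum do rewrite -EFinD box_vol_split.
Qed.

Lemma measurable_ge_coord i (t : R) : measurable [set x : V | (t <= x ord0 i)%R].
Proof.
rewrite (_ : [set x | _] =
  \bigcap_n ~` [set x : V | (x ord0 i <= t - n.+1%:R^-1)%R]).
  by apply: bigcap_measurable => // n _; apply: measurableC; exact: measurable_le_coord.
apply/seteqP; split => x /= tx.
  move=> n _ /=; apply/negP; rewrite -ltNge; apply: lt_le_trans tx.
  by rewrite ltrBlDr ltrDl.
rewrite leNgt; apply/negP => xt.
have [n ] := ltr_add_invr xt; rewrite -ltrBrDr => nt.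
by apply: (tx n) => //=; exact: ltW.
Qed.

Lemma measurable_cube c (r : R) : measurable (cube c r).
Proof.
rewrite (_ : cube c r = \bigcap_(i in @setT 'I_d)
  ([set x : V | (c ord0 i - r / 2 <= x ord0 i)%R] `&`
   [set x : V | (x ord0 i <= c ord0 i + r / 2)%R])).
  apply: fin_bigcap_measurable => // i _; apply: measurableI.
    exact: measurable_ge_coord.
  exact: measurable_le_coord.
apply/seteqP; split => x /= Qx i.
  by move=> _ /=; apply/andP; rewrite -ler_distl; exact: Qx.
by rewrite ler_distl; apply/andP; exact: Qx.
Qed.

(** The map x -> c' + l (x - c) carries a covering of [A] to a covering of [B] and multiplies the
    volume of each box by l^d. *)
Lemma lebesgue_outer_homothety c c' (l : R) (A B : set V) : (0 < l)%R ->
  (forall x, B x -> A (c + l^-1 *: (x - c'))%R) ->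
  lebesgue_outer B <= (l ^+ d)%:E * lebesgue_outer A.
Proof.
move=> l0 BA; have ld0 : (0 < l ^+ d)%R by rewrite exprn_gt0.
rewrite -lee_pdivrMl//; apply: le_ereal_inf_tmp => _ [S [a [b [AS ->]]]].
rewrite lee_pdivrMl//.
pose f (x : V) : V := (c' + l *: (x - c))%R.
have fE x i : f x ord0 i = (c' ord0 i + l * (x ord0 i - c ord0 i))%R by rewrite !mxE.
have volf x y : box_vol (f x) (f y) = (l ^+ d * box_vol x y)%R.
  rewrite /box_vol; have -> : (l ^+ d = \prod_(i < d) l)%R.
    by rewrite prodr_const card_ord.
  rewrite -big_split/=.
  apply: eq_bigr => i _; rewrite !fE -[in RHS](mulr0 l) maxr_pMr ?mulr0 ?(ltW l0)//.
  by rewrite ?mulr0; congr (Num.max _ _); ring.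
apply: (@le_trans _ _ (\esum_(k in S) (box_vol (f (a k)) (f (b k)))%:E)).
  apply: ereal_inf_lbound; exists S, (f \o a), (f \o b); split => // x /BA /AS[k Sk xk].
  exists k => // i /=; rewrite !fE; move: (xk i); rewrite !mxE => /andP[h1 h2].
  apply/andP; split.
    by rewrite -ltrBrDl -ltr_pdivlMl// ltrBlDl.
  by rewrite -lerBlDl -ler_pdivrMl// lerBrDl.
under eq_esum do rewrite volf EFinM.
apply: ge_ereal_sup => _ [F FS <-].
rewrite -ge0_mule_fsumr; last by move=> k; rewrite lee_fin box_vol_ge0.
rewrite lee_pmul2l//; apply: ereal_sup_ubound; by exists F.
Qed.

Lemma leb_cube_scale c (r l : R) : (0 < l)%R ->
  leb (cube c (l * r)) <= (l ^+ d)%:E * leb (cube c r).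
Proof.
move=> l0; apply: (@lebesgue_outer_homothety c c) => // x Qx i.
rewrite !mxE addrAC subrr add0r normrM gtr0_norm ?invr_gt0// ler_pdivrMl//.
by rewrite mulrA; exact: Qx.
Qed.

Lemma leb_cube_lty c (r : R) : leb (cube c r) < +oo.
Proof.
(* The margin 1 is for the left faces, which a half-open box omits. *)
pose e : V := const_mx (`|r| / 2 + 1)%R.
apply: (@le_lt_trans _ _ (box_vol (c - e) (c + e))%:E); last by rewrite ltry.
apply: ereal_inf_lbound; exists [set 0%N], (fun=> c - e)%R, (fun=> c + e)%R; split.
  move=> x Qx; exists 0%N => // i; rewrite !mxE.
  have := Qx i; have := ler_norm r; rewrite ler_distl => h1 /andP[h2 h3].
  by apply/andP; split; lra.
by rewrite esum_set1// lee_fin box_vol_ge0.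
Qed.

End lebesgue_boxes.

(** * Vitali coverings by cubes *)

Section cube_coverings.
Context (R : realType) (d : nat).
Local Notation V := 'rV[R]_d.
Implicit Types (a b : V -> \bar R) (c : V) (r : R) (s : seq (V * R)).

Lemma cube_center c r : (0 <= r)%R -> cube c r c.
Proof. by move=> r0 i; rewrite subrr normr0 divr_ge0. Qed.

Lemma subset_cube c c' r r' : (forall i, `|c ord0 i - c' ord0 i| + r / 2 <= r' / 2)%R ->
  cube c r `<=` cube c' r'.
Proof.
move=> h x Qx i; apply: le_trans (h i).
apply: le_trans (ler_distD (c ord0 i) _ _) _.
by rewrite addrC lerD2l; exact: Qx.
Qed.

Lemma subset_cube_concentric c r r' : (r <= r')%R -> cube c r `<=` cube c r'.
Proof. by move=> rr'; apply: subset_cube => i; rewrite subrr normr0; lra. Qed.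

Lemma cube_engulf c c' r r' : (r' <= r)%R -> cube c r `&` cube c' r' !=set0 ->
  cube c' r' `<=` cube c (3 * r).
Proof.
move=> rr' [z [zc zc']]; apply: subset_cube => i.
have := ler_distD (z ord0 i) (c' ord0 i) (c ord0 i).
by have := zc i; have := zc' i; rewrite (distrC (z _ _) (c' _ _)); lra.
Qed.

Lemma exists_largest_cube s : s != [::] ->
  exists2 Q, Q \in s & forall Q', Q' \in s -> (Q'.2 <= Q.2)%R.
Proof.
elim: s => // Q s ih _; have [->|/ih[Q' Q's Q'max]] := eqVneq s [::].
  by exists Q => [|Q']; rewrite inE// => /eqP ->.
have [QQ'|Q'Q] := leP Q.2 Q'.2.
  exists Q'; first by rewrite inE Q's orbT.
  by move=> Q''; rewrite inE => /predU1P[->//|/Q'max].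
exists Q; first by rewrite mem_head.
move=> Q''; rewrite inE => /predU1P[->//|/Q'max/le_trans]; apply; exact: ltW.
Qed.

Local Notation union s := (\big[setU/set0]_(Q <- s) cube Q.1 Q.2).

Let mU s : measurable (union s).
Proof. by apply: bigsetU_measurable => Q _; exact: measurable_cube. Qed.

(* Remove a largest cube Q together with the cubes meeting it, which all lie in
   3Q; the remaining cubes are disjoint from Q, so the b-integrals add up. *)
Lemma vitali_finite_cubes a b s :
  measurable_fun setT a -> (forall x, 0 <= a x) ->
  measurable_fun setT b -> (forall x, 0 <= b x) ->
  (forall Q, Q \in s -> (0 < Q.2)%R /\
    \int[leb]_(x in cube Q.1 (3 * Q.2)%R) a x <= \int[leb]_(x in cube Q.1 Q.2) b x) ->
  \int[leb]_(x in union s) a x <= \int[leb]_(x in union s) b x.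
Proof.
move=> ma a0 mb b0.
have [n] := ubnP (size s); elim: n s => // n ih s; rewrite ltnS => sn sab.
have [->|s0] := eqVneq s [::]; first by rewrite !big_nil !integral_set0.
have [Q Qs Qmax] := exists_largest_cube s0.
pose t := [seq Q' <- s | `[< cube Q.1 Q.2 `&` cube Q'.1 Q'.2 = set0 >]].
have ts Q' : Q' \in t -> Q' \in s by rewrite mem_filter => /andP[].
have mQ3 : measurable (cube Q.1 (3 * Q.2)%R) by exact: measurable_cube.
have sub : union s `<=` cube Q.1 (3 * Q.2)%R `|` union t.
  rewrite -bigcup_seq => x [Q' /= Q's Q'x].
  have [e|/eqP/set0P QQ'] := pselect (cube Q.1 Q.2 `&` cube Q'.1 Q'.2 = set0).
    by right; rewrite -bigcup_seq; exists Q' => //=; rewrite mem_filter Q's andbT; exact/asboolP.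
  by left; exact: cube_engulf (Qmax _ Q's) QQ' _ Q'x.
apply: (@le_trans _ _ (\int[leb]_(x in cube Q.1 (3 * Q.2)%R `|` union t) a x)).
  apply: ge0_subset_integral => //; [exact: measurableU|exact: measurable_funTS].
apply: le_trans (ge0_integral_setU_le _ mQ3 (mU t) ma a0) _.
have [Q0 Qab] := sab _ Qs.
apply: (@le_trans _ _ (\int[leb]_(x in cube Q.1 Q.2) b x + \int[leb]_(x in union t) b x)).
  apply: leeD => //; apply: ih => [|Q' /ts]; last exact: sab.
  apply: leq_trans sn; rewrite size_filter -(count_predC (fun Q' => `[< cube Q.1 Q.2 `&` cube Q'.1 Q'.2 = set0 >]) s).
  rewrite -[ltnLHS]addn0 ltn_add2l -has_count; apply/hasP; exists Q => //=.
  apply/asboolPn; rewrite setIid => Q_set0.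
  have : cube Q.1 Q.2 Q.1 by apply: cube_center; exact: ltW.
  by rewrite Q_set0.
have mQ : measurable (cube Q.1 Q.2) by exact: measurable_cube.
rewrite -ge0_integral_setU//.
- apply: ge0_subset_integral => //; [exact: measurableU|exact: measurable_funTS|].
  rewrite -!bigcup_seq => x [Qx|[Q' /= /ts Q's Q'x]]; first by exists Q.
  by exists Q'.
- exact: measurable_funTS.
- rewrite disj_set2E; apply/eqP; rewrite -bigcup_seq -subset0 => x [Qx [Q' /=]].
  by rewrite mem_filter => /andP[/asboolP/seteqP[QQ' _] _] Q'x; exact: QQ' (conj Qx Q'x).
Qed.

(** Reduces arbitrary families to countable ones. A side between 6r/5 and 7r/5 and a centre within
    r/10 leave room on both sides: r/10 + r/2 <= r'/2 and r/10 + 3r'/2 <= 11r/5 < 5r/2. This slack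
    is why dilates by 5 occur in the hypotheses, while the finite covering argument works with 3. *)
Lemma rational_cube c r : (0 < r)%R ->
  exists (c' : 'rV[rat]_d) (r' : rat), [/\ (0 < ratr r' :> R)%R,
    cube c r `<=` cube (map_mx ratr c') (ratr r') &
    cube (map_mx ratr c') (3 * ratr r') `<=` cube c (5 * r)].
Proof.
move=> r0.
have [r' ] : exists q : rat, ratr q \in `](6 / 5 * r)%R, (7 / 5 * r)%R[.
  by apply: rat_in_itvoo; lra.
rewrite in_itv/= => /andP[r'1 r'2].
have /choice[e eP] (i : 'I_d) : exists q : rat, (`|c ord0 i - ratr q| <= r / 10)%R.
  have [|q] := @rat_in_itvoo R (c ord0 i - r / 10)%R (c ord0 i + r / 10)%R; first lra.
  rewrite in_itv/= => /andP[h1 h2]; exists q.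
  by rewrite ler_norml; apply/andP; split; lra.
exists (\row_i e i)%R, r'; split; first lra.
- apply: subset_cube => i; rewrite !mxE.
  by have := eP i; lra.
- apply: subset_cube => i; rewrite !mxE distrC.
  by have := eP i; lra.
Qed.

(** The property [good] passes from a cube of the family to the rational cube around it. Hence [F]
    can be the union of all good rational cubes, which is measurable even if the family is
    uncountable; it is exhausted by finite unions, to which [vitali_finite_cubes] applies. *)
Lemma cube_covering a b (P : V -> R -> Prop) :
  measurable_fun setT a -> (forall x, 0 <= a x) ->
  measurable_fun setT b -> (forall x, 0 <= b x) ->
  (forall c r, P c r -> (0 < r)%R /\
    \int[leb]_(x in cube c (5 * r)%R) a x <= \int[leb]_(x in cube c r) b x) ->
  exists F, [/\ measurable F, forall c r, P c r -> cube c r `<=` F &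
    \int[leb]_(x in F) a x <= \int[leb]_x b x].
Proof.
move=> ma a0 mb b0 Pab.
pose good (Q : V * R) := `[< (0 < Q.2)%R /\
  \int[leb]_(x in cube Q.1 (3 * Q.2)%R) a x <= \int[leb]_(x in cube Q.1 Q.2) b x >].
pose real_cube (q : 'rV[rat]_d * rat) : V * R := (map_mx ratr q.1, ratr q.2).
pose L n := [seq Q <- map real_cube (pmap unpickle (iota 0 n)) | good Q].
have LP n Q : Q \in L n <-> good Q /\
    exists k q, [/\ Q = real_cube q, unpickle k = Some q & (k < n)%N].
  rewrite mem_filter; split.
    move=> /andP[-> /mapP[q]]; rewrite mem_pmap => /mapP[k].
    by rewrite mem_iota/= add0n => kn qk ->; split => //; exists k, q.
  move=> [-> [k [q [-> kq kn]]]] /=; apply: map_f; rewrite mem_pmap; apply/mapP.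
  by exists k; rewrite ?mem_iota.
exists (\bigcup_n union (L n)); split.
- exact: bigcup_measurable.
- move=> c r Pcr; have [r0 abr] := Pab _ _ Pcr.
  have goodP c' r' : (0 < r')%R -> cube c r `<=` cube c' r' ->
      cube c' (3 * r')%R `<=` cube c (5 * r)%R -> good (c', r').
    move=> r'0 Qsub subQ; apply/asboolP; split; first by [].
    apply: (@le_trans _ _ (\int[leb]_(x in cube c (5 * r)%R) a x)).
      apply: ge0_subset_integral subQ => //; try exact: measurable_cube.
      exact: measurable_funTS.
    apply: le_trans abr _.
    apply: ge0_subset_integral Qsub => //; try exact: measurable_cube.
    exact: measurable_funTS.
  have [c' [r' [r'0 Qsub subQ]]] := rational_cube c r0.
  have gQ : good (real_cube (c', r')) by exact: (goodP _ _ r'0 Qsub subQ).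
  apply: subset_trans Qsub _.
  move=> x Qx; exists (pickle (c', r')).+1 => //.
  rewrite -bigcup_seq; exists (real_cube (c', r')) => //=.
  by apply/LP; split => //; exists (pickle (c', r')), (c', r'); rewrite pickleK.
- apply: ge0_nondecreasing_integral_le => //.
  + move=> m n mn; apply/subsetPset; rewrite -!bigcup_seq => x [Q /= /LP[gQ [k [q [qE kq km]]]] Qx].
    by exists Q => //=; apply/LP; split => //; exists k, q; split => //; exact: leq_trans mn.
  + move=> n; apply: (@le_trans _ _ (\int[leb]_(x in union (L n)) b x)).
      apply: vitali_finite_cubes => // Q; rewrite mem_filter => /andP[/asboolP//].
    by apply: ge0_subset_integral.
Qed.
End cube_coverings.

(** * Real inequalities and the Hoelder inequality *)

Section real_inequalities.
Context (R : realType).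
Implicit Types (x y t q : R).

(** The endpoints, where a conjugate exponent would be infinite, are included because t = 1/p is 1
    when p = 1. *)
Lemma young_powR x y t : (0 <= x)%R -> (0 <= y)%R -> (0 <= t <= 1)%R ->
  (x `^ t * y `^ (1 - t) <= t * x + (1 - t) * y)%R.
Proof.
move=> x0 y0 /andP[]; rewrite le_eqVlt => /predU1P[<- _|t0].
  by rewrite powRr0 subr0 powRr1// !mul1r mul0r add0r.
rewrite le_eqVlt => /predU1P[->|t1].
  by rewrite subrr powRr0 powRr1// mul1r mulr1 mul0r addr0.
have t'0 : (0 < 1 - t)%R by rewrite subr_gt0.
have := @conjugate_powR R (x `^ t)%R (y `^ (1 - t))%R t^-1%R (1 - t)^-1%R
  (powR_ge0 _ _) (powR_ge0 _ _).
rewrite !invr_gt0 !invrK -!powRrM !divff ?gt_eqF// !powRr1//.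
rewrite (mulrC x) (mulrC y); apply => //; lra.
Qed.

Lemma powRVl x t : (0 <= x)%R -> ((x^-1) `^ t = (x `^ t)^-1)%R.
Proof. by move=> x0; rewrite -powR_inv1// powRAC powR_inv1// powR_ge0. Qed.

(** The surviving terms are an initial segment of a geometric progression of ratio 2^s, so the last
    one, at most y^s, dominates. The exponent will be u for the levels of N and s - 1 for the levels
    of [v]. *)
Lemma sum_truncated_powR (l y s : R) n : (0 < l)%R -> (0 < s)%R -> (0 <= y)%R ->
  (\sum_(k < n) (if (2 ^+ k * l < y)%R then (2 ^+ k * l) `^ s else 0)
   <= (1 - 2 `^ (- s))^-1 * y `^ s)%R.
Proof.
move=> l0 s0 y0; set q := (2 `^ (- s))%R.
have q1 : (q < 1)%R.
  rewrite /q powRN invf_lt1 ?powR_gt0// /powR gt_eqF// -{1}expR0 ltr_expR.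
    by rewrite mulr_gt0// ln_gt0// ltr1n.
have q0 : (0 < q)%R by rewrite powR_gt0.
have q'0 : (0 < 1 - q)%R by rewrite subr_gt0.
have full m : (\sum_(k < m.+1) (2 ^+ k * l) `^ s <= (1 - q)^-1 * (2 ^+ m * l) `^ s)%R.
  elim: m => [|m ih].
    rewrite big_ord1 expr0 mul1r ler_peMl ?powR_ge0// invf_ge1//.
    by rewrite gerBl ltW.
  rewrite big_ord_recr/=; apply: le_trans (lerD ih (lexx _)) _.
  have -> : ((2 ^+ m * l) `^ s = q * (2 ^+ m.+1 * l) `^ s)%R.
    rewrite exprS -(mulrA 2%R) (@powRM _ 2%R) ?mulr_ge0 ?exprn_ge0 1?ltW//.
    by rewrite mulrA /q powRN mulVf ?mul1r// gt_eqF// powR_gt0.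
  rewrite le_eqVlt; apply/orP; left; apply/eqP; field.
  by rewrite gt_eqF.
elim: n => [|n ih]; first by rewrite big_ord0 mulr_ge0 ?invr_ge0 ?powR_ge0 1?ltW.
case: (ltP (2 ^+ n * l)%R y) => [lny|yln]; last first.
  by rewrite big_ord_recr/= ltNge yln/= addr0.
apply: (@le_trans _ _ (\sum_(k < n.+1) (2 ^+ k * l) `^ s)%R).
  by apply: ler_sum => k _; case: ifP => // _; exact: powR_ge0.
apply: le_trans (full n) _.
rewrite ler_pM2l ?invr_gt0//; apply: ge0_ler_powR => //; rewrite ?nnegrE// ltW//.
by rewrite mulr_gt0.
Qed.

End real_inequalities.

Section hoelder_bound.
Context d (T : measurableType d) (R : realType).
Variable mu : {measure set T -> \bar R}.

(** Hoelder's inequality, by integrating Young's inequality for f/A and g/B. The normalization asks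
    for positive bounds; a vanishing integral is left to [integral_powR_eq0]. *)
Lemma integral_powR_le (D : set T) (f g : T -> R) (A B t : R) : measurable D ->
  measurable_fun setT f -> (forall x, 0 <= f x)%R ->
  measurable_fun setT g -> (forall x, 0 <= g x)%R ->
  (0 < A)%R -> \int[mu]_(x in D) (f x)%:E <= A%:E ->
  (0 < B)%R -> \int[mu]_(x in D) (g x)%:E <= B%:E ->
  (0 <= t <= 1)%R ->
  \int[mu]_(x in D) (f x `^ t * g x `^ (1 - t))%:E <= (A `^ t * B `^ (1 - t))%:E.
Proof.
move=> mD mf f0 mg g0 A0 fA B0 gB /andP[t0 t1].
have t'0 : (0 <= 1 - t)%R by rewrite subr_ge0.
set c := (A `^ t * B `^ (1 - t))%R.
have c0 : (0 <= c)%R by rewrite mulr_ge0 ?powR_ge0.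
have mD' (h : T -> R) : measurable_fun setT h -> measurable_fun D (EFin \o h).
  by move=> mh; apply: measurable_funTS; exact/measurable_EFinP.
apply: (@le_trans _ _ (\int[mu]_(x in D)
    ((c * (t / A))%:E * (f x)%:E + (c * ((1 - t) / B))%:E * (g x)%:E))).
  apply: ge0_le_integral => //.
  - by move=> x _; rewrite lee_fin mulr_ge0 ?powR_ge0.
  - by apply: mD'; apply: measurable_funM; exact: (measurableT_comp (measurable_powR _)).
  - apply: (mD' (fun x => c * (t / A) * f x + c * ((1 - t) / B) * g x)%R).
    by apply: measurable_funD; exact: measurable_funM.
  move=> x _; rewrite -!EFinM -EFinD lee_fin.
  have -> : (f x `^ t * g x `^ (1 - t) =
      c * ((f x / A) `^ t * (g x / B) `^ (1 - t)))%R.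
    have divE y z r : (0 <= y)%R -> (0 < z)%R -> ((y / z) `^ r = y `^ r / z `^ r)%R.
      by move=> y0 z0; rewrite powRM ?invr_ge0 ?(ltW z0)// powRVl// ltW.
    by rewrite /c !divE//; field; rewrite !gt_eqF ?powR_gt0.
  have := @young_powR R (f x / A) (g x / B) t.
  rewrite !divr_ge0 ?(ltW A0) ?(ltW B0)// t0 t1 => /(_ isT isT isT) /(ler_wpM2l c0).
  move/le_trans; apply; rewrite le_eqVlt; apply/orP; left; apply/eqP.
  by rewrite mulrDr; congr (_ + _)%R; ring.
rewrite ge0_integralD//; last 4 first.
- by move=> x _; rewrite -EFinM lee_fin mulr_ge0// mulr_ge0// divr_ge0// ltW.
- by apply: (mD' (fun x => c * (t / A) * f x)%R); exact: measurable_funM.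
- by move=> x _; rewrite -EFinM lee_fin mulr_ge0// mulr_ge0// divr_ge0// ltW.
- by apply: (mD' (fun x => c * ((1 - t) / B) * g x)%R); exact: measurable_funM.
rewrite !ge0_integralZl_EFin//; try exact: mD';
  try (by move=> x _; rewrite lee_fin); try by rewrite mulr_ge0// divr_ge0// ltW.
apply: (@le_trans _ _ ((c * (t / A))%:E * A%:E + (c * ((1 - t) / B))%:E * B%:E)).
  by apply: leeD; apply: lee_wpmul2l => //; rewrite lee_fin mulr_ge0// divr_ge0// ltW.
rewrite -!EFinM -EFinD lee_fin le_eqVlt; apply/orP; left; apply/eqP.
by field; rewrite !gt_eqF.
Qed.

End hoelder_bound.

(** * Dyadic levels and the algebra of the A_s condition *)

Section dyadic_levels.
Context (R : realType).
Local Open Scope ring_scope.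
Implicit Types (l y : R).

Lemma dyadic_level l y n : l < y -> y <= 2 ^+ n * l ->
  exists2 k, (k < n)%N & (2 ^+ k * l < y) && (y <= 2 * (2 ^+ k * l)).
Proof.
move=> ly; elim: n => [|n ih]; first by rewrite expr0 mul1r leNgt ly.
have [/ih[k kn kP] _|ny yn] := leP y (2 ^+ n * l).
  by exists k => //; exact: ltnW.
by exists n => //; rewrite ny mulrA -exprS.
Qed.

(** [V] is eliminated between its lower bound and the A_s condition, and the power 1/(s - 1) is
    taken. In P^(s + 1) one factor pays for the A_s condition, one for the [P] beside [N], and P^(s
    - 1) becomes the [P] beside [W] that will offset the doubling constant of W. *)
Lemma bad_cube_powR (s D P M V W N w : R) : 1 < s -> 0 < D -> 0 < P ->
  0 < M -> 0 < V -> 0 < W -> 0 < N -> 0 < w ->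
  V * W `^ (s - 1) <= D * P * M `^ s -> P `^ (s + 1) * M * w <= N * P * V ->
  w `^ (s - 1)^-1 * P * W <= D `^ (s - 1)^-1 * (N `^ (s - 1)^-1 * M).
Proof.
move=> s1 D0 P0 M0 V0 W0 N0 w0 VW bad.
have s10 : 0 < s - 1 by rewrite subr_gt0.
have P0' := ltW P0; have M0' := ltW M0; have W0' := ltW W0.
have N0' := ltW N0; have w0' := ltW w0; have D0' := ltW D0.
have u0 : 0 <= (s - 1)^-1 by rewrite invr_ge0 ltW.
have pw y t : 0 < y -> y `^ (t + 1) = y * y `^ t.
  by move=> y0; rewrite powRD ?(gt_eqF y0) ?implybT// powRr1 1?mulrC// ltW.
have key : w * (P * W) `^ (s - 1) <= D * N * M `^ (s - 1).
  rewrite powRM// -(ler_pM2l (mulr_gt0 (mulr_gt0 P0 P0) M0)).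
  have Ps : P `^ (s + 1) = P * (P * P `^ (s - 1)) by rewrite pw// -[in LHS](subrK 1 s) pw.
  have Ms : M `^ s = M * M `^ (s - 1) by rewrite -[in LHS](subrK 1 s) pw.
  apply: (@le_trans _ _ (P `^ (s + 1) * M * w * W `^ (s - 1))).
    by rewrite Ps le_eqVlt; apply/orP; left; apply/eqP; ring.
  apply: (@le_trans _ _ (N * P * V * W `^ (s - 1))).
    by rewrite ler_pM2r ?powR_gt0.
  apply: (@le_trans _ _ (N * P * (D * P * M `^ s))).
    by rewrite -mulrA ler_pM2l// mulr_gt0.
  by rewrite Ms le_eqVlt; apply/orP; left; apply/eqP; ring.
have := ge0_ler_powR u0 _ _ key.
rewrite !nnegrE !mulr_ge0 ?powR_ge0 ?mulr_ge0// => /(_ isT isT).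
rewrite !powRM ?mulr_ge0 ?powR_ge0// -!powRrM divff ?gt_eqF// !powRr1//.
by rewrite !mulrA.
Qed.

End dyadic_levels.

(** * The mixed weak type inequality for abstract balls *)

Section mixed_weak_type.
Context disp (T : measurableType disp) (R : realType).
Variable mu : {measure set T -> \bar R}.
Implicit Types (x : T) (w : T -> R).

(** An infinite integral has mass 0 under [fine], so finiteness must accompany every use, through
    [massE] or hypotheses such as [int_m]. *)
Definition mass w (E : set T) : R := fine (\int[mu]_(x in E) (w x)%:E).

Lemma massE w E : (forall x, 0 <= w x)%R ->
  \int[mu]_(x in E) (w x)%:E < +oo ->
  \int[mu]_(x in E) (w x)%:E = (mass w E)%:E.
Proof.
move=> w0 wfin; rewrite fineK// ge0_fin_numE//.
by apply: integral_ge0 => x _; rewrite lee_fin.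
Qed.

(* In the application I indexes the cubes, B5 i is the dilate 5 Q of Q = B i,
   and P i is a power of psi (Q). *)
Variables (I : Type) (B B5 : I -> set T) (P : I -> R).
Variables (m v vm wm : T -> R) (s D : R).
Local Notation u := ((s - 1)^-1)%R.

Hypothesis measurable_B : forall i, measurable (B i).
Hypothesis covering : forall (a b : T -> \bar R) (J : I -> Prop),
  measurable_fun setT a -> (forall x, 0 <= a x) ->
  measurable_fun setT b -> (forall x, 0 <= b x) ->
  (forall i, J i -> \int[mu]_(x in B5 i) a x <= \int[mu]_(x in B i) b x) ->
  exists F, [/\ measurable F, forall i, J i -> B i `<=` F &
    \int[mu]_(x in F) a x <= \int[mu]_x b x].
Hypotheses (s1 : (1 < s)%R) (D0 : (0 < D)%R) (P1 : forall i, (1 <= P i)%R).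
Hypotheses (m0 : forall x, (0 < m x)%R) (mm : measurable_fun setT m).
Hypotheses (v0 : forall x, (0 < v x)%R) (mv : measurable_fun setT v).
Hypotheses (vm0 : forall x, (0 < vm x)%R) (mvm : measurable_fun setT vm).
Hypotheses (wm0 : forall x, (0 < wm x)%R) (mwm : measurable_fun setT wm).
Hypothesis vmE : forall x, vm x = (v x * m x)%R.
Hypothesis wmE : forall x, wm x = (v x `^ (- u) * m x)%R.
Hypothesis int_m : forall i, \int[mu]_(x in B i) (m x)%:E = (mass m (B i))%:E /\
  (0 < mass m (B i))%R.
Hypothesis int_vm : forall i, \int[mu]_(x in B i) (vm x)%:E = (mass vm (B i))%:E /\
  (0 < mass vm (B i))%R.
Hypothesis int_wm : forall i, \int[mu]_(x in B i) (wm x)%:E = (mass wm (B i))%:E /\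
  (0 < mass wm (B i))%R.
Hypothesis vm_doubling : forall i,
  \int[mu]_(x in B5 i) (vm x)%:E <= (D * P i * mass vm (B i))%:E.
Hypothesis wm_doubling : forall i,
  \int[mu]_(x in B5 i) (wm x)%:E <= (D * P i * mass wm (B i))%:E.
Hypothesis Ap : forall i,
  (mass vm (B i) * mass wm (B i) `^ (s - 1) <= D * P i * mass m (B i) `^ s)%R.

Let u0 : (0 < u)%R. Proof. by rewrite invr_gt0 subr_gt0. Qed.
Let s0 : (0 < s)%R. Proof. exact: lt_trans s1. Qed.
Let su : (s * u = 1 + u)%R.
Proof. by rewrite -[X in (X * u)%R](subrK 1%R s) mulrDl mul1r divff// gt_eqF// subr_gt0. Qed.

(** Weak type (1,1) for the maximal function N of [g] relative to [vm], with [F] in place of {N >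
    l}. The [P i] in the denominator of the quotients cancels the one in the doubling constant. *)
Lemma weak_type_cover_v (g : T -> R) (l : R) :
  measurable_fun setT g -> (forall x, 0 <= g x)%R -> \int[mu]_x (g x)%:E < +oo ->
  (0 < l)%R ->
  exists F, [/\ measurable F, \int[mu]_(x in F) (vm x)%:E <= (D / l)%:E * \int[mu]_x (g x)%:E &
    forall i, (l * (P i * mass vm (B i)) < mass g (B i))%R ->
      B i `<=` F].
Proof.
move=> mg g0 gfin l0; have Dl0 : (0 <= D / l)%R by rewrite divr_ge0 ?ltW.
have gE i : \int[mu]_(x in B i) (g x)%:E = (mass g (B i))%:E.
  apply: massE => //; apply: le_lt_trans gfin.
  apply: ge0_subset_integral => //; first exact/measurable_EFinP.
  by move=> x _; rewrite lee_fin.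
pose b x : \bar R := (D / l)%:E * (g x)%:E.
have mb : measurable_fun setT b.
  by apply: (measurable_EFinP _ (fun x => D / l * g x)%R).2; exact: measurable_funM.
have bE E : measurable E -> \int[mu]_(x in E) b x = (D / l)%:E * \int[mu]_(x in E) (g x)%:E.
  move=> mE; rewrite ge0_integralZl_EFin//; first by move=> x _; rewrite lee_fin.
  by apply: measurable_funTS; exact/measurable_EFinP.
have [|||||F [mF PF FE]] := @covering (EFin \o vm) b
    (fun i => l * (P i * mass vm (B i)) < mass g (B i))%R.
- exact/measurable_EFinP.
- by move=> x; rewrite lee_fin ltW.
- exact: mb.
- by move=> x; rewrite mule_ge0// lee_fin.
- move=> i lg; apply: le_trans (vm_doubling i) _.
  rewrite bE// gE -EFinM lee_fin.
  rewrite -!mulrA ler_pM2l// ler_pdivlMl// ltW//.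
- by exists F; split => //; rewrite -bE.
Qed.

(** As h m = h v^u wm, the condition on [i] says that the W-average of h v^u, divided by [P i], is
    at least l / L. Values of h v^u below l / (2 L) account for at most half of this, which leaves
    [hm]; the truncation in [hm] makes the bounds summable over dyadic [l]. *)
Lemma weak_type_cover_w (h : T -> R) (l L : R) : (0 < l)%R -> (0 < L)%R ->
  measurable_fun setT h -> (forall x, 0 <= h x)%R ->
  let hm x := if (l < 2 * L * (h x * v x `^ u))%R then (h x * m x)%R else 0%R in
  exists F, [/\ measurable F,
    \int[mu]_(x in F) (wm x)%:E <= (2 * D * L / l)%:E * \int[mu]_x (hm x)%:E &
    forall i, (l * (P i * mass wm (B i)))%:E <=
        L%:E * \int[mu]_(x in B i) (h x * m x)%:E -> B i `<=` F].
Proof.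
move=> l0 L0 mh h0 hm; have K0 : (0 <= 2 * D * L / l)%R.
  by rewrite divr_ge0 ?mulr_ge0 ?ltW.
have mhm : measurable_fun setT hm.
  apply: measurable_fun_if => //.
  - apply: measurable_fun_ltr => //; apply: measurable_funM => //.
    by apply: measurable_funM => //; exact: (measurableT_comp (measurable_powR _)).
  - by apply: measurable_funTS; exact: measurable_funM.
have hm0 x : (0 <= hm x)%R.
  by rewrite /hm; case: ifP => // _; rewrite mulr_ge0// ltW.
pose b x : \bar R := (2 * D * L / l)%:E * (hm x)%:E.
have mb : measurable_fun setT b.
  by apply: (measurable_EFinP _ (fun x => 2 * D * L / l * hm x)%R).2; exact: measurable_funM.
have bE E : measurable E -> \int[mu]_(x in E) b x = (2 * D * L / l)%:E * \int[mu]_(x in E) (hm x)%:E.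
  move=> mE; rewrite ge0_integralZl_EFin//; first by move=> x _; rewrite lee_fin.
  by apply: measurable_funTS; exact/measurable_EFinP.
have [|||||F [mF PF FE]] := @covering (EFin \o wm) b
    (fun i => (l * (P i * mass wm (B i)))%:E <=
        L%:E * \int[mu]_(x in B i) (h x * m x)%:E).
- exact/measurable_EFinP.
- by move=> x; rewrite lee_fin ltW.
- exact: mb.
- by move=> x; rewrite mule_ge0// lee_fin.
- move=> i lh; have mQ := measurable_B i.
  apply: le_trans (wm_doubling i) _; rewrite bE//.
  have [wmi W0] := int_wm i.
  have lL0 : (0 <= l / (2 * L))%R by rewrite divr_ge0 ?mulr_ge0 ?ltW.
  set J := \int[mu]_(x in _) (hm x)%:E.
  (* Where l >= 2 L h v^u, the integrand is at most l / (2 L) times wm; that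
     part is absorbed by the left-hand side of lh. *)
  have split_h : \int[mu]_(x in B i) (h x * m x)%:E <=
      J + (l / (2 * L) * mass wm (B i))%:E.
    rewrite EFinM -wmi -ge0_integralZl_EFin//; last 2 first.
    + by move=> x _; rewrite lee_fin ltW.
    + by apply: measurable_funTS; exact/measurable_EFinP.
    rewrite -ge0_integralD//; last 4 first.
    + by move=> x _; rewrite lee_fin.
    + by apply: measurable_funTS; exact/measurable_EFinP.
    + by move=> x _; rewrite -EFinM lee_fin mulr_ge0// ltW.
    + apply: measurable_funTS.
      by apply: (measurable_EFinP _ (fun x => l / (2 * L) * wm x)%R).2; exact: measurable_funM.
    apply: ge0_le_integral => //.
    + by move=> x _; rewrite lee_fin mulr_ge0// ltW.
    + by apply: measurable_funTS; apply/measurable_EFinP; exact: measurable_funM.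
    + apply: measurable_funTS.
      apply: (measurable_EFinP _ (fun x => hm x + l / (2 * L) * wm x)%R).2.
      by apply: measurable_funD => //; exact: measurable_funM.
    move=> x _; rewrite -EFinM -EFinD lee_fin /hm wmE.
    case: ltP => [_|hl]; first by rewrite lerDl mulr_ge0//; rewrite -wmE; exact: ltW.
    rewrite add0r mulrA ler_pM2r// powRN.
    rewrite ler_pdivlMr ?powR_gt0// ler_pdivlMr ?mulr_gt0//.
    by move: hl; lra.
  have J0 : 0 <= J by apply: integral_ge0 => x _; rewrite lee_fin.
  move: J0 split_h; case: J => [j|_ _|//]; last first.
    by rewrite gt0_muley ?leey// lte_fin divr_gt0 ?mulr_gt0.
  rewrite lee_fin -EFinD => j0 split_h; rewrite -EFinM lee_fin.
  have : (l * (P i * mass wm (B i)))%:E <= L%:E * (j + l / (2 * L) * mass wm (B i))%:E.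
    by apply: le_trans lh _; apply: lee_wpmul2l => //; rewrite lee_fin ltW.
  rewrite -EFinM lee_fin.
  have -> : (L * (j + l / (2 * L) * mass wm (B i)) = L * j + l * mass wm (B i) / 2)%R.
    by field; rewrite gt_eqF.
  move=> key.
  have PW : (l * mass wm (B i) <= l * (P i * mass wm (B i)))%R.
    by rewrite ler_pM2l// ler_peMl ?P1// ltW.
  rewrite -mulrA.
  have -> : (2 * D * L / l * j = D * (2 * (L * j) / l))%R by field; rewrite gt_eqF.
  rewrite ler_pM2l// ler_pdivlMr// mulrC; lra.
- by exists F; split => //; rewrite -bE.
Qed.


Lemma integral_indic_mul (E : set T) (w : T -> R) :
  \int[mu]_x (\1_E x * w x)%:E = \int[mu]_(x in E) (w x)%:E.
Proof.
rewrite [RHS]integral_mkcond; apply: eq_integral => x _.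
by rewrite patchE indicE; case: ifPn => _; rewrite ?mul1r ?mul0r.
Qed.

(** [L] is the constant of [bad_cube_powR] and [geo] that of a geometric series. In [C1], 2^(1 + u)
    comes from rounding N up to a dyadic level, [D] from the covering. In [C2], 2^s comes from
    rounding v^u up, [2 * D * L] from [weak_type_cover_w], and the rest from summing the powers
    lam^(s - 1) below 2 L h v^u. *)
Let L : R := (D `^ u)%R.
Let geo (t : R) : R := ((1 - 2 `^ (- t))^-1)%R.
Let C1 : R := (2 `^ (1 + u) * D * (geo u * 2 `^ u))%R.
Let C2 : R := (2 `^ s * (2 * D * L) * geo (s - 1) * (2 * L) `^ (s - 1))%R.

Let L0 : (0 < L)%R. Proof. exact: powR_gt0. Qed.

Let geo_gt0 t : (0 < t)%R -> (0 < geo t)%R.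
Proof.
move=> t0; rewrite invr_gt0 subr_gt0 powRN invf_lt1 ?powR_gt0//.
by rewrite /powR gt_eqF// -{1}expR0 ltr_expR mulr_gt0// ln_gt0// ltr1n.
Qed.

Let C1_gt0 : (0 < C1)%R.
Proof. by rewrite !mulr_gt0 ?powR_gt0 ?geo_gt0. Qed.

Let C2_gt0 : (0 < C2)%R.
Proof. by rewrite !mulr_gt0 ?powR_gt0 ?geo_gt0 ?mulr_gt0 ?L0 ?subr_gt0 ?invr_gt0. Qed.

(** The cut-off version: v^u and the quotient of the cube are kept away from 0, and v^u also from
    infinity, so finitely many levels occur. The bound does not depend on [n]. *)
Lemma mixed_weak_type_level (g : T -> R) (n : nat) :
  measurable_fun setT g -> (forall x, 0 <= g x)%R -> \int[mu]_x (g x)%:E < +oo ->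
  exists F, [/\ measurable F,
    \int[mu]_(x in F) (vm x)%:E <= (D + C2 * C1)%:E * \int[mu]_x (g x)%:E &
    forall x i, B i x ->
      ((2 ^+ n)^-1 < v x `^ u <= 2 ^+ n)%R ->
      ((2 ^+ n)^-1 * (P i * mass vm (B i)) < mass g (B i))%R ->
      (P i `^ (s + 1) * mass m (B i) * v x < mass g (B i))%R -> F x].
Proof.
move=> mg g0 gfin.
(* lam k = 2^(k - n): the indices k < n cover quotients in (2^-n, 1], k = n is the level 1, and k <
   2n covers the range of v^u. *)
pose lam k : R := (2 ^+ k * (2 ^+ n)^-1)%R.
have lam0 k : (0 < lam k)%R by rewrite mulr_gt0 ?invr_gt0 ?exprn_gt0.
have lam0' k := ltW (lam0 k).
have ln0 : (0 < (2 ^+ n)^-1 :> R)%R by rewrite invr_gt0 exprn_gt0.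
have lamn : lam n = 1%R by rewrite /lam divff// gt_eqF// exprn_gt0.
have /choice[Om OmP] k := weak_type_cover_v mg g0 gfin (lam0 k).
have mOm k : measurable (Om k) by case: (OmP k).
have vmOm k : \int[mu]_(x in Om k) (vm x)%:E <= (D / lam k)%:E * \int[mu]_x (g x)%:E.
  by case: (OmP k).
(* N being the maximal function of g relative to vm, h = H^(1/s) is a measurable
   majorant of min(N, 1)^u on the cubes Q where N is at least 2^-n. *)
pose H x : R := (\sum_(k < n.+1) (2 * lam k) `^ (1 + u) * \1_(Om k) x)%R.
have e0 k : (0 <= (2 * lam k) `^ (1 + u))%R by exact: powR_ge0.
have H0 x : (0 <= H x)%R by apply: sumr_ge0 => k _; rewrite mulr_ge0// indicE.
have mH : measurable_fun setT H.
  by apply: measurable_sum => k; apply: measurable_funM => //; exact: measurable_indic.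
have intH : \int[mu]_x (H x * vm x)%:E <= C1%:E * \int[mu]_x (g x)%:E.
  have -> : \int[mu]_x (H x * vm x)%:E = \sum_(k < n.+1)
      ((2 * lam k) `^ (1 + u))%:E * \int[mu]_(x in Om k) (vm x)%:E.
    transitivity (\int[mu]_x \sum_(k < n.+1)
        ((2 * lam k) `^ (1 + u))%:E * (\1_(Om k) x * vm x)%:E).
      apply: eq_integral => x _; rewrite /H mulr_suml -sumEFin.
      by apply: eq_bigr => k _; rewrite -EFinM -mulrA.
    have mi k : measurable_fun setT (fun x => \1_(Om k) x * vm x)%R.
      by apply: measurable_funM => //; exact: measurable_indic.
    have i0 k x : (0 <= \1_(Om k) x * vm x)%R by rewrite mulr_ge0 ?indicE// ltW.
    rewrite ge0_integral_sum//.
    - apply: eq_bigr => k _; rewrite ge0_integralZl_EFin ?integral_indic_mul//.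
      + by move=> x _; rewrite lee_fin.
      + exact/measurable_EFinP.
    - move=> k; apply: (measurable_EFinP _ (fun x => (2 * lam k) `^ (1 + u) * (\1_(Om k) x * vm x))%R).2.
      exact: measurable_funM.
    - by move=> k x _; rewrite -EFinM lee_fin mulr_ge0 ?e0 ?i0.
  apply: (@le_trans _ _ (\sum_(k < n.+1) ((2 * lam k) `^ (1 + u))%:E *
      ((D / lam k)%:E * \int[mu]_x (g x)%:E))).
    by apply: lee_sum => k _; apply: lee_wpmul2l; rewrite ?lee_fin.
  under eq_bigr do rewrite muleA -EFinM.
  rewrite -ge0_sume_distrl; last by move=> k _; rewrite lee_fin mulr_ge0// divr_ge0// ltW.
  apply: lee_wpmul2r; first by apply: integral_ge0 => x _; rewrite lee_fin.
  rewrite sumEFin lee_fin.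
  have uu : (0 < 1 + u)%R by rewrite addr_gt0.
  (* The factor 1 / lam of the weak type bound leaves lam^u, whose sum over levels up to 1 is
     bounded since u > 0. *)
  have -> : (\sum_(k < n.+1) (2 * lam k) `^ (1 + u) * (D / lam k) =
     2 `^ (1 + u) * D * \sum_(k < n.+1) lam k `^ u)%R.
    rewrite mulr_sumr; apply: eq_bigr => k _; rewrite powRM//.
    rewrite (@powRD _ (lam k)) ?(gt_eqF uu)// powRr1//.
    by field; rewrite gt_eqF.
  rewrite ler_pM2l ?mulr_gt0 ?powR_gt0//.
  (* The truncation height 2 keeps every term, as lam k <= 1 < 2. *)
  apply: le_trans (sum_truncated_powR n.+1 ln0 u0 (ler0n R 2)).
  apply: ler_sum => k _; rewrite ifT//; apply: (@le_lt_trans _ _ 1%R); last by rewrite ltr1n.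
  by rewrite ler_pdivrMr ?exprn_gt0// mul1r ler_weXn2l// ?ler1n// -ltnS.
pose h x : R := (H x `^ s^-1)%R.
have h0 x : (0 <= h x)%R by exact: powR_ge0.
have mh : measurable_fun setT h by exact: (measurableT_comp (measurable_powR _)).
have hOm k x : (k < n.+1)%N -> Om k x -> ((2 * lam k) `^ u <= h x)%R.
  move=> kn Omkx.
  have -> : ((2 * lam k) `^ u = ((2 * lam k) `^ (1 + u)) `^ s^-1)%R.
    by rewrite -powRrM -su mulrAC divff ?mul1r// gt_eqF.
  apply: ge0_ler_powR; rewrite ?nnegrE ?invr_ge0 ?(ltW s0)//.
  rewrite /H (bigD1 (Ordinal kn))//= indicE mem_set// mulr1 lerDl.
  by apply: sumr_ge0 => j _; rewrite mulr_ge0// indicE.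
have /choice[Fs FsP] k := weak_type_cover_w (lam0 k) L0 mh h0.
have mFs k : measurable (Fs k) by case: (FsP k).
have mvu : measurable_fun setT (fun x => v x `^ u)%R.
  exact: (measurableT_comp (measurable_powR _)).
(* [Fs k] is controlled in W-measure only; on [S k] this passes to V, because v = (v^u)^s v^(-u) <=
   (2 lam k)^s v^(-u). *)
pose S k := [set x | (v x `^ u <= 2 * lam k)%R].
have mS k : measurable (S k).
  rewrite -[S k]setTI; apply: measurable_fun_le => //.
have mFB k : measurable (Fs k `&` S k) by exact: measurableI.
(* [Om n] takes the points in cubes with quotient above 1; any other bad point falls into the piece
   of the dyadic level of its v^u. *)
exists (Om n `|` \big[setU/set0]_(k < n + n) (Fs k `&` S k)); split.
- by apply: measurableU => //; exact: bigsetU_measurable.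
- have mvmE : measurable_fun setT (fun x => (vm x)%:E) by exact/measurable_EFinP.
  have vm0E x : 0 <= (vm x)%:E by rewrite lee_fin ltW.
  have mU : measurable (\big[setU/set0]_(k < n + n) (Fs k `&` S k)).
    exact: bigsetU_measurable.
  apply: le_trans (ge0_integral_setU_le mu (mOm n) mU mvmE vm0E) _.
  have D0E : 0 <= D%:E by rewrite lee_fin ltW.
  have CE : 0 <= (C2 * C1)%:E by rewrite lee_fin ltW// mulr_gt0.
  rewrite EFinD ge0_muleDl//.
  apply: leeD; first by have := vmOm n; rewrite lamn divr1.
  apply: le_trans (ge0_integral_bigsetU_le mu _ _ _ mvmE vm0E) _ => //.
  apply: (@le_trans _ _ (C2%:E * \int[mu]_x (H x * vm x)%:E)); last first.
    by rewrite (EFinM C2 C1) -muleA; apply: lee_wpmul2l => //; rewrite lee_fin ltW.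
  pose hm k x : R := (if lam k < 2 * L * (h x * v x `^ u) then h x * m x else 0)%R.
  have mhm k : measurable_fun setT (hm k).
    apply: measurable_fun_if => //.
    - apply: measurable_fun_ltr => //; apply: measurable_funM => //.
      exact: measurable_funM.
    - by apply: measurable_funTS; exact: measurable_funM.
  have hm0 k x : (0 <= hm k x)%R by rewrite /hm; case: ifP => // _; rewrite mulr_ge0// ltW.
  (* (2 lam)^s from passing to V on [S k], times 2 D L / lam from the weak type bound. *)
  pose e k : R := (2 `^ s * (2 * D * L) * lam k `^ (s - 1))%R.
  have ee0 k : (0 <= e k)%R by rewrite !mulr_ge0 ?powR_ge0 ?ltW.
  apply: (@le_trans _ _ (\sum_(k < n + n) (e k)%:E * \int[mu]_x (hm k x)%:E)).
    apply: lee_sum => k _.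
    have -> : (e k = (2 * lam k) `^ s * (2 * D * L / lam k))%R.
      rewrite /e powRM// -(mulr_powRB1 (lam0' k) s0).
      by field; rewrite gt_eqF.
    have [_ FsW _] := FsP k; rewrite (EFinM ((2 * lam k) `^ s)) -muleA.
    apply: (@le_trans _ _ (((2 * lam k) `^ s)%:E * \int[mu]_(x in Fs k) (wm x)%:E)); last first.
      by apply: lee_wpmul2l => //; rewrite lee_fin powR_ge0.
    have wm0E x : 0 <= (wm x)%:E by rewrite lee_fin ltW.
    apply: (@le_trans _ _ (((2 * lam k) `^ s)%:E * \int[mu]_(x in Fs k `&` S k) (wm x)%:E)); last first.
      apply: lee_wpmul2l; first by rewrite lee_fin powR_ge0.
      apply: ge0_subset_integral => //; apply: measurable_funTS; exact/measurable_EFinP.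
    rewrite -ge0_integralZl_EFin ?powR_ge0//; last first.
      by apply: measurable_funTS; exact/measurable_EFinP.
    apply: ge0_le_integral => //.
    - exact: measurable_funTS.
    - apply: measurable_funTS.
      apply: (measurable_EFinP _ (fun x => (2 * lam k) `^ s * wm x)%R).2; exact: measurable_funM.
    move=> x [_ /= vS]; rewrite -EFinM lee_fin vmE wmE mulrA ler_pM2r//.
    have {1}-> : (v x = (v x `^ u) `^ s * v x `^ (- u))%R.
      rewrite -powRrM -powRD ?(gt_eqF (v0 x)) ?implybT//.
      by rewrite mulrC su addrK powRr1// ltW.
    rewrite ler_pM2r ?powR_gt0//; apply: ge0_ler_powR; rewrite ?nnegrE ?powR_ge0 ?mulr_ge0//.
    exact: ltW.
  under eq_bigr => k _.
    rewrite -ge0_integralZl_EFin//; [|by move=> x _; rewrite lee_fin|exact/measurable_EFinP].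
    over.
  rewrite -ge0_integral_sum//; last 2 first.
  + move=> k; apply: (measurable_EFinP _ (fun x => e k * hm k x)%R).2; exact: measurable_funM.
  + by move=> k x _; rewrite -EFinM lee_fin mulr_ge0.
  rewrite -ge0_integralZl_EFin ?(ltW C2_gt0)//; last 2 first.
  + by move=> x _; rewrite lee_fin mulr_ge0// ltW.
  + by apply/measurable_EFinP; exact: measurable_funM.
  apply: ge0_le_integral => //.
  + by move=> x _; apply: sume_ge0 => k _; rewrite -EFinM lee_fin mulr_ge0.
  + apply: emeasurable_sum => k.
    apply: (measurable_EFinP _ (fun x => e k * hm k x)%R).2; exact: measurable_funM.
  + apply: (measurable_EFinP _ (fun x => C2 * (H x * vm x))%R).2.
    by apply: measurable_funM => //; exact: measurable_funM.
  (* Pointwise, only levels below y = 2 L h v^u survive; their powers lam^(s - 1) add up to a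
     multiple of (h v^u)^(s - 1) = h^(s - 1) v, and multiplication by h m gives h^s v m = H vm. *)
  move=> x _; under eq_bigr do rewrite -EFinM.
  rewrite sumEFin -EFinM lee_fin.
  set y : R := (2 * L * (h x * v x `^ u))%R.
  have y0 : (0 <= y)%R by rewrite !mulr_ge0 ?powR_ge0 ?(ltW L0).
  have -> : (\sum_(k < n + n) e k * hm k x = 2 `^ s * (2 * D * L) * (h x * m x) *
      \sum_(k < n + n) (if lam k < y then lam k `^ (s - 1) else 0))%R.
    rewrite mulr_sumr; apply: eq_bigr => k _; rewrite /e /hm -/y.
    by case: ifP => _; rewrite ?mulr0//; ring.
  have s10 : (0 < s - 1)%R by rewrite subr_gt0.
  have cm0 : (0 <= 2 `^ s * (2 * D * L) * (h x * m x))%R.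
    by rewrite !mulr_ge0 ?powR_ge0 ?(ltW L0) ?(ltW D0) ?(ltW (m0 x)).
  apply: le_trans (ler_wpM2l cm0 (sum_truncated_powR (n + n) ln0 s10 y0)) _.
  rewrite le_eqVlt; apply/orP; left; apply/eqP.
  rewrite /y powRM ?mulr_ge0 ?powR_ge0 ?(ltW L0)// (@powRM _ (h x)) ?powR_ge0//.
  rewrite -(@powRrM _ (v x)) /u mulVf ?gt_eqF// powRr1 ?(ltW (v0 x))//.
  have -> : H x = (h x * h x `^ (s - 1))%R.
    rewrite mulr_powRB1// /h -powRrM mulVf ?powRr1// gt_eqF//.
  by rewrite /C2 /geo vmE; ring.
- move=> x i Qx /andP[vl vn] lG bad.
  have [Omx|nOmx] := pselect (Om n x); [by left|right].
  have [[mi M0] [_ V0] [wmi W0]] := And3 (int_m i) (int_vm i) (int_wm i).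
  have P0 : (0 < P i)%R by apply: lt_le_trans (P1 i).
  have PV0 : (0 < P i * mass vm (B i))%R by rewrite mulr_gt0.
  have GPV : (mass g (B i) <= P i * mass vm (B i))%R.
    rewrite leNgt; apply/negP => h1; apply: nOmx.
    by have [_ _ /(_ i)] := OmP n; rewrite lamn mul1r => /(_ h1); exact.
  (* The quotient of this one cube suffices: all of [B i] lies in [Om k], so h >= N^u on the whole
     cube and not only at [x]. *)
  pose N : R := (mass g (B i) / (P i * mass vm (B i)))%R.
  have lN : ((2 ^+ n)^-1 < N)%R by rewrite /N ltr_pdivlMr.
  have N1 : (N <= 2 ^+ n * (2 ^+ n)^-1)%R.
    by rewrite divff ?gt_eqF ?exprn_gt0// /N ler_pdivrMr// mul1r.
  have [k kn /andP[kN Nk]] := dyadic_level lN N1.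
  have N0 : (0 < N)%R by apply: lt_trans kN; exact: lam0.
  have subOm : B i `<=` Om k.
    by have [_ _] := OmP k; apply; rewrite -ltr_pdivlMr.
  have hN y : B i y -> (N `^ u <= h y)%R.
    move=> /subOm Omy; apply: le_trans (hOm k y (ltnW kn) Omy).
    apply: ge0_ler_powR => //; rewrite ?nnegrE; [exact: ltW|exact: ltW|exact: mulr_ge0].
  have NM : (N `^ u * mass m (B i))%:E <= \int[mu]_(x in B i) (h x * m x)%:E.
    rewrite EFinM -mi -ge0_integralZl_EFin ?powR_ge0//; last 2 first.
    - by move=> y _; rewrite lee_fin ltW.
    - by apply: measurable_funTS; exact/measurable_EFinP.
    apply: ge0_le_integral => //.
    - by move=> y _; rewrite -EFinM lee_fin mulr_ge0 ?powR_ge0// ltW.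
    - apply: measurable_funTS.
      apply: (measurable_EFinP _ (fun x => N `^ u * m x)%R).2; exact: measurable_funM.
    - by apply: measurable_funTS; apply/measurable_EFinP; exact: measurable_funM.
    by move=> y By; rewrite -EFinM lee_fin ler_pM2r// hN.
  have bad' : (P i `^ (s + 1) * mass m (B i) * v x <= N * P i * mass vm (B i))%R.
    by rewrite -(mulrA N) /N divfK ?(gt_eqF PV0)// ltW.
  have key := bad_cube_powR s1 D0 P0 M0 V0 W0 N0 (v0 x) (Ap i) bad'.
  have [|k' k'n /andP[k'v vk']] := @dyadic_level R _ (v x `^ u)%R (n + n) vl.
    by rewrite exprD -mulrA divff ?mulr1// gt_eqF// exprn_gt0.
  rewrite -bigcup_seq; exists (Ordinal k'n); first exact: mem_index_enum.
  split; last exact: vk'.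
  have [_ _ FsB] := FsP k'; apply: (FsB i) => //.
  apply: (@le_trans _ _ (L * (N `^ u * mass m (B i)))%:E); last first.
    by rewrite EFinM; apply: lee_wpmul2l => //; rewrite lee_fin ltW.
  rewrite lee_fin; apply: le_trans key.
  by rewrite mulrA ler_pM2r// ler_pM2r// ltW.
Qed.

(** The sets [E n] of bad points obeying the cut-off 2^-n increase and exhaust all bad points, so
    [ge0_integral_cover_limit] applies to their covers. *)
Lemma mixed_weak_type : exists2 C : R, (0 < C)%R & forall g : T -> R,
  measurable_fun setT g -> (forall x, 0 <= g x)%R -> \int[mu]_x (g x)%:E < +oo ->
  exists F, [/\ measurable F,
    \int[mu]_(x in F) (vm x)%:E <= C%:E * \int[mu]_x (g x)%:E &
    forall x i, B i x ->
      (P i `^ (s + 1) * mass m (B i) * v x < mass g (B i))%R -> F x].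
Proof.
exists (D + C2 * C1)%R; first by rewrite addr_gt0// mulr_gt0.
move=> g mg g0 gfin.
have mvmE : measurable_fun setT (fun x => (vm x)%:E) by exact/measurable_EFinP.
have vm0E x : 0 <= (vm x)%:E by rewrite lee_fin ltW.
have /choice[F FP] n := mixed_weak_type_level n mg g0 gfin.
pose E n := [set x | exists i, [/\ B i x, ((2 ^+ n)^-1 < v x `^ u <= 2 ^+ n)%R,
  ((2 ^+ n)^-1 * (P i * mass vm (B i)) < mass g (B i))%R &
  (P i `^ (s + 1) * mass m (B i) * v x < mass g (B i))%R]].
have [||||||G [mG EG intG]] := @ge0_integral_cover_limit _ _ _ mu E F (fun x => (vm x)%:E)
  ((D + C2 * C1)%:E * \int[mu]_x (g x)%:E).
- apply/nondecreasing_seqP => n; apply/subsetPset => x [i [Bx /andP[vl vn] gl bad]].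
  have le2 : (2 ^+ n <= 2 ^+ n.+1 :> R)%R by rewrite ler_eXn2l ?ltr1n.
  have le2V : ((2 ^+ n.+1)^-1 <= (2 ^+ n)^-1 :> R)%R by rewrite lef_pV2 ?posrE ?exprn_gt0.
  exists i; split => //.
    by rewrite (le_lt_trans le2V vl) (le_trans vn le2).
  apply: le_lt_trans gl; apply: ler_wpM2r le2V.
  by rewrite mulr_ge0//; [apply: le_trans (P1 i)|case: (int_vm i) => _ /ltW].
- by move=> n x [i [Bx vl gl bad]]; have [_ _] := FP n; apply; eassumption.
- by move=> n; case: (FP n).
- exact: mvmE.
- exact: vm0E.
- by move=> n; case: (FP n).
exists G; split => // x i Bx bad; apply: EG.
have [_ M0] := int_m i; have [_ V0] := int_vm i.
have P0 : (0 < P i)%R by apply: lt_le_trans (P1 i).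
(* Positivity of this mass is what makes the cut-off on the quotient hold for large [n]. *)
have G0 : (0 < mass g (B i))%R.
  by apply: le_lt_trans bad; rewrite !mulr_ge0 ?powR_ge0 ?ltW.
have pow2 (y : R) : exists n, forall k, (n <= k)%N -> (y < 2 ^+ k)%R.
  exists (Num.truncn y).+1 => k yk; apply: lt_le_trans (truncnS_gt y) _.
  apply: (@le_trans _ _ k%:R%R); first by rewrite ler_nat.
  by rewrite -natrX ler_nat; apply: ltnW; exact: ltn_expl.
have vu0 : (0 < v x `^ u)%R by exact: powR_gt0.
have PV0 : (0 < P i * mass vm (B i))%R by rewrite mulr_gt0.
have [n1 n1P] := pow2 (v x `^ u)%R.
have [n2 n2P] := pow2 (v x `^ u)^-1%R.
have [n3 n3P] := pow2 ((mass g (B i))^-1 * (P i * mass vm (B i)))%R.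
pose n := maxn n1 (maxn n2 n3).
exists n => //; exists i; split => //.
  apply/andP; split; last by apply/ltW/n1P; rewrite /n leq_maxl.
  rewrite -[ltRHS]invrK ltf_pV2 ?posrE ?exprn_gt0 ?invr_gt0//.
  by apply: n2P; rewrite /n !leq_max leqnn orbT.
rewrite ltr_pdivrMl ?exprn_gt0// [ltRHS]mulrC -ltr_pdivrMl//.
by apply: n3P; rewrite /n !leq_max leqnn !orbT.
Qed.

End mixed_weak_type.

(** * The mixed weak type inequality for cubes *)

Section doubling.
Context disp (T : measurableType disp) (R : realType).
Variable mu : {measure set T -> \bar R}.

(** On [Q5] the A_s condition and doubling of [m] give V5 W5^(s - 1) <= E^(s + 1) M1^s. Hoelder on
    [Q] bounds M1^s by V1 W5^(s - 1) or by V5 W1^(s - 1), after enlarging one of the two integrals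
    to [Q5]; the common factor cancels. *)
Lemma Ap_doubling (Q Q5 : set T) (m vm wm : T -> R) (s E M1 M5 V1 V5 W1 W5 : R) :
  (1 < s)%R -> (0 < E)%R -> measurable Q -> measurable Q5 -> Q `<=` Q5 ->
  measurable_fun setT vm -> (forall x, 0 < vm x)%R ->
  measurable_fun setT wm -> (forall x, 0 < wm x)%R ->
  (forall x, m x = vm x `^ s^-1 * wm x `^ (1 - s^-1))%R ->
  (0 < M1)%R -> (0 < M5)%R -> (0 < V1)%R -> (0 < V5)%R -> (0 < W1)%R -> (0 < W5)%R ->
  \int[mu]_(x in Q) (m x)%:E = M1%:E ->
  \int[mu]_(x in Q) (vm x)%:E = V1%:E -> \int[mu]_(x in Q5) (vm x)%:E = V5%:E ->
  \int[mu]_(x in Q) (wm x)%:E = W1%:E -> \int[mu]_(x in Q5) (wm x)%:E = W5%:E ->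
  (M5 <= E * M1)%R -> (V5 * W5 `^ (s - 1) <= E * M5 `^ s)%R ->
  (V5 <= E `^ (s + 1) * V1)%R /\ (W5 <= (E `^ (s + 1)) `^ (s - 1)^-1 * W1)%R.
Proof.
move=> s1 E0 mQ mQ5 QQ5 mvm vm0 mwm wm0 mE M10 M50 V10 V50 W10 W50 M1E V1E V5E W1E W5E M51 Ap.
have s0 : (0 < s)%R by apply: lt_trans s1.
have s10 : (0 < s - 1)%R by rewrite subr_gt0.
have hoelder_M A B : (0 < A)%R -> (0 < B)%R -> \int[mu]_(x in Q) (vm x)%:E <= A%:E ->
    \int[mu]_(x in Q) (wm x)%:E <= B%:E -> (M1 `^ s <= A * B `^ (s - 1))%R.
  move=> A0 B0 vA wB.
  have : M1%:E <= (A `^ s^-1 * B `^ (1 - s^-1))%:E.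
    rewrite -M1E; under eq_integral do rewrite mE.
    apply: integral_powR_le => //; try by move=> x; exact: ltW.
    by rewrite invr_ge0 invf_le1// !ltW.
  rewrite lee_fin => h.
  have := ge0_ler_powR (ltW s0) _ _ h.
  rewrite !nnegrE mulr_ge0 ?powR_ge0// (ltW M10) => /(_ isT isT) /le_trans; apply.
  rewrite powRM ?powR_ge0// -!powRrM mulVf ?gt_eqF// powRr1 ?(ltW A0)//.
  by rewrite mulrBl mul1r mulVf ?gt_eqF.
have sub5 (w : T -> R) a : measurable_fun setT w -> (forall x, 0 < w x)%R ->
    \int[mu]_(x in Q5) (w x)%:E = a -> \int[mu]_(x in Q) (w x)%:E <= a.
  move=> mw w0 <-; apply: ge0_subset_integral => //.
    by apply: measurable_funTS; exact/measurable_EFinP.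
  by move=> x _; rewrite lee_fin ltW.
have M5s : (M5 `^ s <= E `^ s * M1 `^ s)%R.
  rewrite -powRM ?(ltW E0) ?(ltW M10)//; apply: ge0_ler_powR => //; rewrite ?nnegrE ?mulr_ge0//; exact: ltW.
have Es : (E `^ (s + 1) = E * E `^ s)%R.
  by rewrite powRD ?(gt_eqF E0) ?implybT// powRr1 1?mulrC// ltW.
have key : (V5 * W5 `^ (s - 1) <= E `^ (s + 1) * M1 `^ s)%R.
  by apply: le_trans Ap _; rewrite Es -mulrA ler_pM2l.
split.
  rewrite -(@ler_pM2r _ (W5 `^ (s - 1))%R) ?powR_gt0//.
  apply: le_trans key _; rewrite -mulrA ler_pM2l ?powR_gt0//.
  by apply: hoelder_M => //; [rewrite V1E|exact: sub5].
have h : (W5 `^ (s - 1) <= E `^ (s + 1) * W1 `^ (s - 1))%R.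
  rewrite -(@ler_pM2l _ V5)//; apply: le_trans key _; rewrite mulrCA ler_pM2l ?powR_gt0//.
  by apply: hoelder_M => //; [exact: sub5|rewrite W1E].
have s'0 : (0 <= (s - 1)^-1)%R by rewrite invr_ge0 ltW.
have := ge0_ler_powR s'0 _ _ h.
rewrite !nnegrE mulr_ge0 ?powR_ge0// => /(_ isT isT).
rewrite powRM ?powR_ge0// -!(@powRrM _ _ (s - 1)) divff ?gt_eqF//.
by rewrite !powRr1 ?(ltW W10) ?(ltW W50).
Qed.

End doubling.

Section mixed_weak_type_on_cubes.
Context (R : realType) (d : nat).
Local Notation V := 'rV[R]_d.

Lemma powR_ge1 (a t : R) : (1 <= a)%R -> (0 <= t)%R -> (1 <= a `^ t)%R.
Proof. by move=> a1 t0; rewrite -[leLHS](powRr0 a) ler_powR. Qed.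

Lemma psi_ge1 (rho : V -> R) (theta : R) c r : (0 < rho c)%R -> (0 <= theta)%R ->
  (0 < r)%R -> (1 <= psi rho theta c r)%R.
Proof.
by move=> rho0 th0 r0; rewrite powR_ge1// lerDl divr_ge0 ?ltW.
Qed.

Lemma psi_dilate (rho : V -> R) (theta : R) c r : (0 < rho c)%R -> (0 <= theta)%R ->
  (0 < r)%R -> (psi rho theta c (5 * r) <= 5 `^ theta * psi rho theta c r)%R.
Proof.
move=> rho0 th0 r0; have rr0 : (0 <= r / rho c)%R by rewrite divr_ge0 ?ltW.
rewrite /psi -powRM ?addr_ge0//; apply: ge0_ler_powR; rewrite ?nnegrE//.
- by rewrite -mulrA addr_ge0// mulr_ge0.
- by rewrite mulr_ge0// addr_ge0.
- by rewrite -mulrA mulrDr mulr1 lerD2r ler1n.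
Qed.

Lemma psi_powR (rho : V -> R) (theta t : R) c r :
  (psi rho theta c r `^ t = psi rho (theta * t) c r)%R.
Proof. by rewrite /psi powRrM. Qed.

Lemma mixed_weak_type_cubes (rho m v vm wm : V -> R) (s K k : R) :
  (forall x, 0 < rho x)%R -> (1 < s)%R -> (1 <= K)%R -> (0 <= k)%R ->
  measurable_fun setT m -> (forall x, 0 < m x)%R ->
  measurable_fun setT v -> (forall x, 0 < v x)%R ->
  (forall x, vm x = v x * m x)%R -> (forall x, wm x = v x `^ (- (s - 1)^-1) * m x)%R ->
  let integrable_pos (w : V -> R) := forall c r, (0 < r)%R ->
    \int[leb]_(x in cube c r) (w x)%:E = (mass leb w (cube c r))%:E /\
    (0 < mass leb w (cube c r))%R in
  integrable_pos m -> integrable_pos vm -> integrable_pos wm ->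
  (forall c r, (0 < r)%R ->
    mass leb m (cube c (5 * r)) <= K * psi rho k c r * mass leb m (cube c r))%R ->
  (forall c r, (0 < r)%R ->
    mass leb vm (cube c r) * mass leb wm (cube c r) `^ (s - 1) <=
      K * psi rho k c r * mass leb m (cube c r) `^ s)%R ->
  exists theta C : R, [/\ (0 <= theta)%R, (0 < C)%R & forall g : V -> R,
    measurable_fun setT g -> (forall x, 0 <= g x)%R -> \int[leb]_x (g x)%:E < +oo ->
    exists F, [/\ measurable F,
      \int[leb]_(x in F) (vm x)%:E <= C%:E * \int[leb]_x (g x)%:E &
      forall x c r, (0 < r)%R -> cube c r x ->
        (psi rho theta c r * mass leb m (cube c r) * v x < mass leb g (cube c r))%R -> F x]].
Proof.
move=> rho0 s1 K1 k0 mm m0 mv v0 vmE wmE intpos mpos vmpos wmpos m_doubling Ap.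
have s10 : (0 < s - 1)%R by rewrite subr_gt0.
have s0 : (0 < s)%R by apply: lt_trans s1.
have K0 : (0 < K)%R by apply: lt_le_trans K1.
have mvm : measurable_fun setT vm.
  by rewrite (_ : vm = fun x => v x * m x)%R; [exact: measurable_funM|apply/funext].
have mwm : measurable_fun setT wm.
  rewrite (_ : wm = fun x => v x `^ (- (s - 1)^-1) * m x)%R; last exact/funext.
  exact: (measurable_funM (measurableT_comp (measurable_powR _) mv) mm).
have vm0 x : (0 < vm x)%R by rewrite vmE mulr_gt0.
have wm0 x : (0 < wm x)%R by rewrite wmE mulr_gt0// powR_gt0.
have mE x : (m x = vm x `^ s^-1 * wm x `^ (1 - s^-1))%R.
  rewrite vmE wmE !powRM ?powR_ge0 ?(ltW (v0 x)) ?(ltW (m0 x))// mulrACA.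
  rewrite -powRrM -!powRD ?(gt_eqF (m0 x)) ?(gt_eqF (v0 x)) ?implybT//.
  have -> : (s^-1 + (1 - s^-1) = 1)%R by ring.
  have -> : (s^-1 + - (s - 1)^-1 * (1 - s^-1) = 0)%R by field; rewrite !gt_eqF.
  by rewrite powRr0 mul1r powRr1// ltW.
(* [Ap_doubling] yields the exponents s + 1 for V and (s + 1) / (s - 1) for W; [e] dominates both,
   so one [D] and one [P] serve for all hypotheses. *)
pose e : R := ((s + 1) * Num.max 1 (s - 1)^-1)%R.
pose I := {Q : V * R | (0 < Q.2)%R}.
pose B (i : I) := cube (val i).1 (val i).2.
pose B5 (i : I) := cube (val i).1 (5 * (val i).2)%R.
pose P (i : I) := psi rho (k * e) (val i).1 (val i).2.
pose D : R := ((K * 5 `^ k) `^ e)%R.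
have I0 (i : I) : (0 < (val i).2)%R := valP i.
have max1 : (1 <= Num.max 1 (s - 1)^-1)%R by rewrite le_max lexx.
have e1 : (s + 1 <= e)%R by rewrite /e ler_peMr// addr_ge0 1?ltW.
have e2 : ((s + 1) * (s - 1)^-1 <= e)%R.
  by rewrite /e ler_pM2l ?addr_gt0// le_max lexx orbT.
have e0 : (0 <= e)%R by apply: le_trans e1; rewrite addr_ge0// ltW.
have e11 : (1 <= e)%R by apply: le_trans e1; rewrite lerDr ltW.
have DP i : (D * P i = (K * 5 `^ k * psi rho k (val i).1 (val i).2) `^ e)%R.
  by rewrite /D /P -psi_powR -powRM ?mulr_ge0 ?powR_ge0// ltW.
have base1 (i : I) : (1 <= K * 5 `^ k * psi rho k (val i).1 (val i).2)%R.
  have p1 : (1 <= psi rho k (val i).1 (val i).2)%R by exact: psi_ge1 (rho0 _) k0 (I0 i).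
  have p5 : (1 <= 5 `^ k :> R)%R by rewrite powR_ge1// ler1n.
  by rewrite !mulr_ege1.
have bound (i : I) t y : (t <= e)%R -> (0 <= y)%R ->
    ((K * 5 `^ k * psi rho k (val i).1 (val i).2) `^ t * y <= D * P i * y)%R.
  move=> te y0; have h := ler_powR (base1 i) te.
  by rewrite -DP in h; exact: ler_wpM2r y0 _ _ h.
have doubling i : (mass leb vm (B5 i) <= D * P i * mass leb vm (B i))%R /\
    (mass leb wm (B5 i) <= D * P i * mass leb wm (B i))%R.
  case: i => -[c r] /= r0; set i := exist _ _ _.
  have r50 : (0 < 5 * r)%R by rewrite mulr_gt0.
  have [[mi M1] [vmi V1] [wmi W1]] := And3 (mpos c r r0) (vmpos c r r0) (wmpos c r r0).
  have [[mi5 M5] [vmi5 V5] [wmi5 W5]] := And3 (mpos c _ r50) (vmpos c _ r50) (wmpos c _ r50).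
  have b0 : (0 < K * 5 `^ k * psi rho k c r)%R by apply: lt_le_trans (base1 i).
  have le5 : (K * psi rho k c r <= K * 5 `^ k * psi rho k c r)%R.
    rewrite -mulrA ler_pM2l// ler_peMl ?powR_ge0//.
    by rewrite powR_ge1// ler1n.
  have sub : cube c r `<=` cube c (5 * r)%R.
    by apply: subset_cube_concentric; rewrite ler_peMl ?ler1n// ltW.
  have md : (mass leb m (cube c (5 * r)) <=
      K * 5 `^ k * psi rho k c r * mass leb m (cube c r))%R.
    apply: le_trans (m_doubling c r r0) _; apply: ler_wpM2r le5; exact: ltW.
  have Ap5 : (mass leb vm (cube c (5 * r)) * mass leb wm (cube c (5 * r)) `^ (s - 1) <=
      K * 5 `^ k * psi rho k c r * mass leb m (cube c (5 * r)) `^ s)%R.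
    apply: le_trans (Ap c _ r50) _; apply: ler_wpM2r; first exact: powR_ge0.
    by rewrite -(mulrA K) ler_pM2l//; exact: psi_dilate.
  have [dv dw] := Ap_doubling s1 b0 (measurable_cube c r) (measurable_cube c (5 * r)%R)
    sub mvm vm0 mwm wm0 mE M1 M5 V1 V5 W1 W5 mi vmi vmi5 wmi wmi5 md Ap5.
  split; first by apply: le_trans dv _; exact: (bound i _ _ e1 (ltW V1)).
  by apply: le_trans dw _; rewrite -powRrM; exact: (bound i _ _ e2 (ltW W1)).
have mB i : measurable (B i) by exact: measurable_cube.
have D0 : (0 < D)%R by rewrite powR_gt0// mulr_gt0// powR_gt0.
have P1 i : (1 <= P i)%R by exact: psi_ge1 (rho0 _) (mulr_ge0 k0 e0) (I0 i).
have cov (a b : V -> \bar R) (J : I -> Prop) :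
    measurable_fun setT a -> (forall x, 0 <= a x) ->
    measurable_fun setT b -> (forall x, 0 <= b x) ->
    (forall i, J i -> \int[leb]_(x in B5 i) a x <= \int[leb]_(x in B i) b x) ->
    exists F, [/\ measurable F, forall i, J i -> B i `<=` F &
      \int[leb]_(x in F) a x <= \int[leb]_x b x].
  move=> ma a0 mb b0 Jab.
  have [|F [mF JF Fab]] := @cube_covering R d a b
      (fun c r => exists2 i : I, J i & val i = (c, r)) ma a0 mb b0.
    move=> c r [i Ji ie]; have := I0 i; have := Jab i Ji.
    by rewrite /B /B5 ie.
  exists F; split => // i Ji; apply: JF; exists i => //; exact: surjective_pairing.
have mposI i : \int[leb]_(x in B i) (m x)%:E = (mass leb m (B i))%:E /\
    (0 < mass leb m (B i))%R by exact: mpos (I0 i).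
have vmposI i : \int[leb]_(x in B i) (vm x)%:E = (mass leb vm (B i))%:E /\
    (0 < mass leb vm (B i))%R by exact: vmpos (I0 i).
have wmposI i : \int[leb]_(x in B i) (wm x)%:E = (mass leb wm (B i))%:E /\
    (0 < mass leb wm (B i))%R by exact: wmpos (I0 i).
have r50 (i : I) : (0 < 5 * (val i).2)%R by rewrite mulr_gt0.
have vm_dbl i : \int[leb]_(x in B5 i) (vm x)%:E <= (D * P i * mass leb vm (B i))%:E.
  by rewrite (vmpos _ _ (r50 i)).1 lee_fin; exact: (doubling i).1.
have wm_dbl i : \int[leb]_(x in B5 i) (wm x)%:E <= (D * P i * mass leb wm (B i))%:E.
  by rewrite (wmpos _ _ (r50 i)).1 lee_fin; exact: (doubling i).2.
have ApI i : (mass leb vm (B i) * mass leb wm (B i) `^ (s - 1) <=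
    D * P i * mass leb m (B i) `^ s)%R.
  apply: le_trans (Ap _ _ (I0 i)) _.
  apply: le_trans (bound i 1%R _ e11 (powR_ge0 _ _)); apply: ler_wpM2r; first exact: powR_ge0.
  rewrite powRr1; last exact: le_trans (base1 i).
  rewrite -[leRHS]mulrA ler_pM2l// ler_peMl ?powR_ge0//.
  by rewrite powR_ge1// ler1n.
have [C C0 CP] := @mixed_weak_type _ V R leb I B B5 P m v vm wm s D mB cov s1 D0 P1
  m0 mm v0 mv vm0 mvm wm0 mwm vmE wmE mposI vmposI wmposI vm_dbl wm_dbl ApI.
(* This exponent makes psi equal to P^(s + 1). *)
exists (k * e * (s + 1))%R, C; split => //.
  by apply: mulr_ge0; [exact: mulr_ge0|exact: ltW (addr_gt0 s0 ltr01)].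
move=> g mg g0 gfin; have [F [mF FC FP]] := CP g mg g0 gfin.
exists F; split => // x c r r0 Qx bad.
apply: (FP x (exist _ (c, r) r0)) => //.
by rewrite /P psi_powR.
Qed.

End mixed_weak_type_on_cubes.

(** * Consequences of the Muckenhoupt conditions *)

Section weights.
Context disp (T : measurableType disp) (R : realType).
Variable mu : {measure set T -> \bar R}.

Lemma integral_gt0 (D : set T) (f : T -> R) : measurable D -> 0 < mu D ->
  measurable_fun setT f -> (forall x, 0 < f x)%R -> 0 < \int[mu]_(x in D) (f x)%:E.
Proof.
move=> mD D0 mf f0; rewrite lt_def integral_ge0 ?andbT; last first.
  by move=> x _; rewrite lee_fin ltW.
apply/eqP => int0; move: D0; suff -> : mu D = 0 by rewrite ltxx.
have mfE : measurable_fun D (EFin \o f) by apply: measurable_funTS; exact/measurable_EFinP.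
have /(ae_eq_integral_abs mu mD mfE)[N [mN N0 DN]] :
    \int[mu]_(x in D) `|(EFin \o f) x| = 0.
  by rewrite -int0; apply: eq_integral => x _; rewrite /= gtr0_norm.
apply: (subset_measure0 mD mN _ N0) => x Dx; apply: DN => /= h.
by have [] := h Dx; apply/eqP; rewrite gt_eqF.
Qed.

Lemma integral_representative (D : set T) (f : T -> \bar R) (g : T -> R) :
  measurable D -> measurable_fun setT f -> measurable_fun setT g ->
  {ae mu, forall x, f x = (g x)%:E} ->
  \int[mu]_(x in D) f x = \int[mu]_(x in D) (g x)%:E.
Proof.
move=> mD mf mg fg; apply: ae_eq_integral => //; [exact: measurable_funTS| |].
  by apply: measurable_funTS; exact/measurable_EFinP.
by apply: filterS fg => x fx _.
Qed.

(** Weights are changed on a null set, so that powers and quotients are computed with positive reals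
    everywhere. *)
Lemma positive_representative (w : T -> \bar R) : measurable_fun setT w ->
  {ae mu, forall x, 0 < w x < +oo} ->
  exists w1 : T -> R, [/\ measurable_fun setT w1, forall x, (0 < w1 x)%R &
    {ae mu, forall x, w x = (w1 x)%:E}].
Proof.
move=> mw w0; exists (fun x => if (0 < fine (w x))%R then fine (w x) else 1%R); split.
- have mfw : measurable_fun setT (fine \o w) by exact: measurableT_comp.
  apply: measurable_fun_ifT => //.
  exact: measurable_fun_ltr.
- by move=> x; case: ifP.
- apply: filterS w0 => x; case: (w x) => //= [r|/andP[]//].
  by rewrite lte_fin => /andP[-> _].
Qed.

(** The norm of order +oo is the essential supremum only on a space of positive measure, hence the
    first hypothesis. *)
Lemma ess_sup_inv_ge (Q : set T) (w : T -> \bar R) (w1 : T -> R) :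
  0 < mu setT -> (forall x, 0 < w1 x)%R -> {ae mu, forall x, w x = (w1 x)%:E} ->
  {ae mu, forall x, Q x -> ((w1 x)^-1)%:E <= 'N[mu]_(+oo)[(fun x => (w x)^-1) \_ Q]}.
Proof.
move=> T0 w10 ww1; rewrite unlock T0.
set f := abse \o _; have := ess_sup_ge mu f; apply: filterS2 ww1 => x wx fx Qx.
apply: le_trans fx; rewrite /f /= patchE mem_set// wx inver gt_eqF//.
by rewrite lee_fin ler_norm.
Qed.

(** A product bounded by a real forces finite factors only if none of them is 0, as 0 times +oo is
    0. [N] is positive because [Q], having positive measure, contains a point where [N] dominates 1
    / w1. *)
Lemma A1_bound (Q : set T) (w1 : T -> R) (a K : R) (i N : \bar R) :
  measurable Q -> 0 < mu Q -> (0 < a)%R -> 0 < i -> (forall x, 0 < w1 x)%R ->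
  {ae mu, forall x, Q x -> ((w1 x)^-1)%:E <= N} ->
  a%:E^-1 * i * N <= K%:E ->
  exists i' n : R, [/\ i = i'%:E, N = n%:E, (0 < n)%R & (i' * n <= K * a)%R].
Proof.
move=> mQ Q0 a0 i0 w10 wN; rewrite inver gt_eqF// => iNK.
have ia0 : 0 < (a^-1)%:E * i by rewrite mule_gt0// lte_fin invr_gt0.
have [x Qx xN] : exists2 x, Q x & ((w1 x)^-1)%:E <= N.
  apply: contrapT => noN; move: Q0; case: wN => Z [mZ Z0 QZ].
  suff -> : mu Q = 0 by rewrite ltxx.
  apply: (subset_measure0 mQ mZ _ Z0) => x Qx; apply: QZ => /= h.
  by apply: noN; exists x => //; exact: h.
have N0 : 0 < N by apply: lt_le_trans xN; rewrite lte_fin invr_gt0.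
have Nfin : N != +oo.
  by apply/eqP => NE; move: iNK; rewrite NE gt0_muley// leye_eq.
have ifin : i != +oo.
  by apply/eqP => iE; move: iNK; rewrite iE gt0_muley ?lte_fin ?invr_gt0// gt0_mulye// leye_eq.
case: N N0 Nfin iNK {wN xN} => [n| |]//; rewrite lte_fin => n0 _.
case: i i0 ifin {ia0} => [i'| |]//; rewrite lte_fin => i0 _.
rewrite -!EFinM lee_fin => h; exists i', n; split => //.
by rewrite -ler_pdivrMr//; apply: le_trans h; rewrite mulrC mulrA.
Qed.

Lemma As_bound (a K s : R) (i j : \bar R) :
  (0 < a)%R -> 0 < i -> 0 < j -> (1 < s)%R ->
  a%:E^-1 * i * (a%:E^-1 * j) `^ (s - 1) <= K%:E ->
  exists i' j' : R, [/\ i = i'%:E, j = j'%:E & (i' * j' `^ (s - 1) <= K * a `^ s)%R].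
Proof.
move=> a0 i0 j0 s1; rewrite inver gt_eqF// => h.
have s10 : (0 < s - 1)%R by rewrite subr_gt0.
have s0 : (0 < s)%R by apply: lt_trans s1.
have a'0 : 0 < (a^-1)%:E by rewrite lte_fin invr_gt0.
have ai0 : 0 < (a^-1)%:E * i by rewrite mule_gt0.
have aj0 : 0 < ((a^-1)%:E * j) `^ (s - 1) by rewrite poweR_gt0// mule_gt0.
have jfin : j != +oo.
  apply/eqP => jE; move: h; rewrite jE gt0_muley// poweRyr ?gt_eqF//.
  by rewrite gt0_muley// leye_eq.
have ifin : i != +oo.
  by apply/eqP => iE; move: h; rewrite iE gt0_muley// gt0_mulye// leye_eq.
case: i i0 ifin h {ai0} => [i'| |]// i0 _; case: j j0 jfin {aj0} => [j'| |]// j0 _.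
rewrite -!EFinM lee_fin => h; exists i', j'; split => //.
rewrite lte_fin in i0; rewrite lte_fin in j0.
apply: le_trans (ler_wpM2r (powR_ge0 a s) h).
rewrite -(mulr_powRB1 (ltW a0) s0) powRM ?powRVl ?invr_ge0 ?(ltW a0) ?(ltW j0)// le_eqVlt.
by apply/orP; left; apply/eqP; field; rewrite !gt_eqF ?powR_gt0.
Qed.

End weights.

Section muckenhoupt_classes.
Context (R : realType) (d : nat).
Local Notation V := 'rV[R]_d.

Lemma conj_expE (s : R) : (1 < s)%R -> conj_exp s = (s / (s - 1))%R.
Proof.
move=> s1; have s0 : (0 < s)%R by apply: lt_trans s1.
rewrite /conj_exp /hoelder_conjugate /= eqe gt_eqF// inver subr_eq0 gt_eqF//.
Qed.

Lemma div_conjE (q p : R) : (1 <= p)%R -> div_conj q p = (q - q / p)%R.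
Proof.
rewrite le_eqVlt => /predU1P[<-|p1]; rewrite /div_conj /hoelder_conjugate /=.
  by rewrite eqe oner_eq0 inver subrr eqxx mul1e invey mule0 invr1 mulr1 subrr.
have p0 : (0 < p)%R by apply: lt_trans p1.
have p10 : (0 < p - 1)%R by rewrite subr_gt0.
rewrite eqe gt_eqF// inver subr_eq0 gt_eqF//= inver mulf_eq0 invr_eq0 !gt_eqF//=.
by field; rewrite !gt_eqF.
Qed.

Variable rho : V -> R.
Hypothesis rho0 : forall x, (0 < rho x)%R.
Hypothesis leb_cube_gt0 : forall c r, (0 < r)%R -> 0 < leb (cube c r : set V).

(** The volume of the cube, not its side-length. *)
Let side c r : R := fine (leb (cube c r : set V)).

Lemma leb_cubeE c r : leb (cube c r : set V) = (side c r)%:E.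
Proof. by rewrite fineK// ge0_fin_numE// leb_cube_lty. Qed.

Let side_gt0 c r : (0 < r)%R -> (0 < side c r)%R.
Proof. by move=> r0; have := leb_cube_gt0 c r0; rewrite leb_cubeE lte_fin. Qed.

Let lebT_gt0 : 0 < leb [set: V].
Proof.
apply: lt_le_trans (leb_cube_gt0 0%R ltr01) _; apply: le_measure; rewrite ?inE//.
exact: measurable_cube.
Qed.

Let psi0 th c r : (0 < r)%R -> (0 < psi rho th c r)%R.
Proof. by move=> r0; rewrite powR_gt0// addr_gt0// divr_gt0. Qed.

Lemma A_class_theta_bound (theta s : R) (mu0 w : V -> \bar R) :
  A_class_theta rho theta mu0 s w -> exists2 K : R, (0 < K)%R &
    forall c r, (0 < r)%R -> A_quantity rho theta mu0 s w c r <= K%:E.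
Proof.
rewrite /A_class_theta; set S := ereal_sup _ => Sfin.
have [K K0 SK] : exists2 K : R, (0 < K)%R & S <= K%:E.
  case: S Sfin => [r _| |_]//; last by exists 1%R => //; rewrite leNye.
  by exists (Num.max 1 r)%R; rewrite ?lt_max ?ltr01// lee_fin le_max lexx orbT.
exists K => // c r r0; apply: le_trans SK.
by apply: ereal_sup_ubound; exists c, r.
Qed.

(** The A_1 condition in pointwise form. The finiteness of the integrals of [m] over cubes also
    comes from that of the A_1 quantity. *)
Lemma A1_cubes (mu0 : V -> \bar R) (m : V -> R) :
  measurable_fun setT mu0 -> measurable_fun setT m -> (forall x, 0 < m x)%R ->
  {ae leb, forall x, mu0 x = (m x)%:E} -> A_class rho (fun=> 1) 1%R mu0 ->
  exists K theta : R, [/\ (0 < K)%R, (0 <= theta)%R & forall c r, (0 < r)%R ->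
    [/\ \int[leb]_(x in cube c r) (m x)%:E = (mass leb m (cube c r))%:E,
      (0 < mass leb m (cube c r))%R &
      {ae leb, forall x, cube c r x ->
        mass leb m (cube c r) <= K * psi rho theta c r * side c r * m x}%R]].
Proof.
move=> mmu0 mm m0 mu0m [theta th0 /A_class_theta_bound[K K0 AK]].
exists K, theta; split => // c r r0; have := AK c r r0; rewrite /A_quantity eqxx.
have mQ := measurable_cube c r.
rewrite {1}/wmeasure integral_cst// mul1e leb_cubeE -EFinM.
have -> : \int[leb]_(x in cube c r) (mu0 x * 1) = \int[leb]_(x in cube c r) (m x)%:E.
  by under eq_integral do rewrite mule1; exact: integral_representative.
have Q0 := leb_cube_gt0 c r0.
have i0 := integral_gt0 mQ Q0 mm m0.
have a0 : (0 < psi rho theta c r * side c r)%R.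
  by apply: mulr_gt0; [exact: psi0|exact: side_gt0].
move=> /(A1_bound mQ Q0 a0 i0 m0 (ess_sup_inv_ge (cube c r) lebT_gt0 m0 mu0m)).
move=> [i [n [iE NE n0 le_in]]].
have massE : mass leb m (cube c r) = i by rewrite /mass iE.
rewrite massE; split => //.
  by move: i0; rewrite iE lte_fin.
have := ess_sup_inv_ge (cube c r) lebT_gt0 m0 mu0m; rewrite NE.
apply: filterS => x /[apply]; rewrite lee_fin => xn.
have ige0 : (0 <= i)%R by move: i0; rewrite iE lte_fin => /ltW.
rewrite -ler_pdivrMr// -(mulrA K); apply: le_trans le_in.
exact: ler_wpM2l.
Qed.

Lemma A_infty_cubes (mu0 w : V -> \bar R) (m v : V -> R) :
  measurable_fun setT mu0 -> measurable_fun setT m -> (forall x, 0 < m x)%R ->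
  {ae leb, forall x, mu0 x = (m x)%:E} ->
  measurable_fun setT w -> measurable_fun setT v -> (forall x, 0 < v x)%R ->
  {ae leb, forall x, w x = (v x)%:E} ->
  (forall c r, (0 < r)%R ->
    \int[leb]_(x in cube c r) (m x)%:E = (mass leb m (cube c r))%:E /\
    (0 < mass leb m (cube c r))%R) ->
  A_infty rho mu0 w ->
  exists s K k : R, [/\ (1 < s)%R, (0 < K)%R, (0 <= k)%R &
    let vm x := (v x * m x)%R in let wm x := (v x `^ (- (s - 1)^-1) * m x)%R in
    forall c r, (0 < r)%R ->
    [/\ \int[leb]_(x in cube c r) (vm x)%:E = (mass leb vm (cube c r))%:E /\
      (0 < mass leb vm (cube c r))%R,
      \int[leb]_(x in cube c r) (wm x)%:E = (mass leb wm (cube c r))%:E /\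
      (0 < mass leb wm (cube c r))%R &
      (mass leb vm (cube c r) * mass leb wm (cube c r) `^ (s - 1) <=
        K * psi rho k c r * mass leb m (cube c r) `^ s)%R]].
Proof.
move=> mmu0 mm m0 mu0m mw mv v0 wv mpos [s s1 [k k0 /A_class_theta_bound[K K0 AK]]].
have mvm : measurable_fun setT (fun x => v x * m x)%R by exact: measurable_funM.
have vm0 x : (0 < v x * m x)%R by exact: mulr_gt0.
have mvt t : measurable_fun setT (fun x => v x `^ t)%R.
  exact: (measurableT_comp (measurable_powR _) mv).
have mwm t : measurable_fun setT (fun x => v x `^ t * m x)%R by exact: measurable_funM.
have wm0 t x : (0 < v x `^ t * m x)%R by rewrite mulr_gt0// powR_gt0.
have avgE c r : (0 < r)%R -> (psi rho k c r)%:E * wmeasure mu0 (cube c r) =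
    (psi rho k c r * mass leb m (cube c r))%:E.
  move=> r0; rewrite /wmeasure (integral_representative (measurable_cube c r) mmu0 mm mu0m).
  by rewrite (mpos c r r0).1.
have wmu0E c r : \int[leb]_(x in cube c r) (w x * mu0 x) =
    \int[leb]_(x in cube c r) (v x * m x)%:E.
  apply: (integral_representative (measurable_cube c r) _ mvm).
    exact: emeasurable_funM.
  by apply: filterS2 mu0m wv => x -> ->.
have wtmu0E t c r : \int[leb]_(x in cube c r) (w x `^ t * mu0 x) =
    \int[leb]_(x in cube c r) (v x `^ t * m x)%:E.
  apply: (integral_representative (measurable_cube c r) _ (mwm t)).
    apply: emeasurable_funM mmu0.
    exact: (measurableT_comp (measurable_poweR _) mw).
  by apply: filterS2 mu0m wv => x -> ->.
have [s_eq1|s_neq1] := eqVneq s 1%R.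
  (* A_1 is contained in A_2: the essential bound [n] on 1 / v gives W(Q) <= n m(Q). *)
  exists 2%R, K, k; split; [by rewrite ltr1n|exact: K0|exact: k0|].
  have -> : (2 - 1 = 1 :> R)%R by ring.
  move=> vm wm c r r0; have := AK c r r0; rewrite /A_quantity s_eq1 eqxx (avgE c r r0) wmu0E.
  have [mi M0] := mpos c r r0.
  have mQ := measurable_cube c r; have Q0 := leb_cube_gt0 c r0.
  have i0 := integral_gt0 mQ Q0 mvm vm0.
  have j0 := integral_gt0 mQ Q0 (mwm (- 1^-1)%R) (wm0 _).
  have a0 : (0 < psi rho k c r * mass leb m (cube c r))%R by rewrite mulr_gt0// psi0.
  have ess := ess_sup_inv_ge (cube c r) lebT_gt0 v0 wv.
  move=> /(A1_bound mQ Q0 a0 i0 v0 ess)[i [n [iE NE n0 le_in]]].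
  have jn : \int[leb]_(x in cube c r) (wm x)%:E <= (n * mass leb m (cube c r))%:E.
    have mE : measurable_fun (cube c r) (EFin \o m) by apply: measurable_funTS; exact/measurable_EFinP.
    rewrite EFinM -mi -(ge0_integralZl_EFin leb mQ _ mE (ltW n0)); last first.
      by move=> x _; rewrite lee_fin ltW.
    apply: (ae_ge0_le_integral mQ).
    - by move=> x _; rewrite lee_fin; exact: ltW (wm0 _ x).
    - by apply: measurable_funTS; apply/measurable_EFinP; exact: mwm.
    - by move=> x _; rewrite mule_ge0 ?lee_fin ?(ltW n0) ?(ltW (m0 x)).
    - apply: measurable_funTS.
      by apply: (measurable_EFinP _ (fun x => n * m x)%R).2; exact: measurable_funM.
    move: ess; rewrite NE; apply: filterS => x /[apply].
    rewrite -EFinM !lee_fin => vn; rewrite /wm invr1 powR_inv1 ?(ltW (v0 x))//.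
    by apply: ler_wpM2r vn; exact: ltW.
  have jE : \int[leb]_(x in cube c r) (wm x)%:E = (mass leb wm (cube c r))%:E.
    rewrite /mass fineK// ge0_fin_numE ?(ltW j0)//; apply: le_lt_trans jn _; exact: ltry.
  have iE' : mass leb vm (cube c r) = i by rewrite /mass /vm iE.
  have W0 : (0 < mass leb wm (cube c r))%R by rewrite -lte_fin -jE.
  have I0 : (0 < i)%R by rewrite -lte_fin -iE.
  rewrite iE'; split; [exact: conj iE I0|exact: conj jE W0|].
  rewrite powRr1 ?(ltW W0)// powR_mulrn ?(ltW M0)// expr2.
  have {}jn : (mass leb wm (cube c r) <= n * mass leb m (cube c r))%R by rewrite -lee_fin -jE.
  apply: le_trans (ler_wpM2l (ltW I0) jn) _.
  by rewrite [leLHS]mulrA [leRHS]mulrA; apply: ler_wpM2r; [exact: ltW|rewrite -mulrA].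
have {}s1 : (1 < s)%R by rewrite lt_neqAle eq_sym s_neq1.
have s0 : (0 < s)%R by exact: lt_trans s1.
(* The first average carries psi and the second psi^(s - 1), together psi^s. *)
exists s, K, (k * s)%R; split; [exact: s1|exact: K0|exact: mulr_ge0 k0 (ltW s0)|].
move=> vm wm c r r0; have := AK c r r0; rewrite /A_quantity (negbTE s_neq1) (avgE c r r0) wmu0E wtmu0E.
have -> : (1 - conj_exp s = - (s - 1)^-1)%R.
  by rewrite conj_expE//; field; rewrite subr_eq0.
have [mi M0] := mpos c r r0.
have mQ := measurable_cube c r; have Q0 := leb_cube_gt0 c r0.
have i0 := integral_gt0 mQ Q0 mvm vm0.
have j0 := integral_gt0 mQ Q0 (mwm (- (s - 1)^-1)%R) (wm0 _).
have a0 : (0 < psi rho k c r * mass leb m (cube c r))%R by rewrite mulr_gt0// psi0.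
move=> /(As_bound a0 i0 j0 s1)[i [j [iE jE le_ij]]].
have iE' : mass leb vm (cube c r) = i by rewrite /mass /vm iE.
have jE' : mass leb wm (cube c r) = j by rewrite /mass /wm jE.
have I0 : (0 < i)%R by rewrite -lte_fin -iE.
have J0 : (0 < j)%R by rewrite -lte_fin -jE.
rewrite iE' jE'; split; [exact: conj iE I0|exact: conj jE J0|].
apply: le_trans le_ij _.
by rewrite powRM ?(ltW M0) ?(ltW (psi0 _ _ r0))// psi_powR mulrA.
Qed.

End muckenhoupt_classes.

(** * Reduction of the fractional operator *)

Section integrals_over_arbitrary_sets.
Context disp (T : measurableType disp) (R : realType).
Variable mu : {measure set T -> \bar R}.
Implicit Types (E F N : set T) (f g w : T -> \bar R).

(* [\int] of a nonnegative function is the supremum of the integrals of the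
   simple functions below it, hence monotone without any measurability. *)
Lemma ge0_le_integral_any f g : (forall x, 0 <= f x) -> (forall x, f x <= g x) ->
  \int[mu]_x f x <= \int[mu]_x g x.
Proof.
move=> f0 fg; have g0 x : 0 <= g x by apply: le_trans (fg x).
rewrite !ge0_integralTE//; apply: le_ereal_sup => _ [h hf <-].
by exists h => // x; apply: le_trans (hf x) (fg x).
Qed.

Lemma negligible_integral_any N f : measurable N -> mu N = 0 ->
  (forall x, 0 <= f x) -> (forall x, ~ N x -> f x = 0) -> \int[mu]_x f x = 0.
Proof.
move=> mN N0 f0 fN; apply/eqP; rewrite eq_le integral_ge0// andbT.
apply: (@le_trans _ _ (\int[mu]_x (cst +oo \_ N) x)).
  apply: ge0_le_integral_any => // x; rewrite patchE.
  by case: ifPn => [_|/negP xN]; rewrite ?leey// fN// => Nx; apply: xN; rewrite inE.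
by rewrite -integral_mkcond integral_cst// N0 mule0.
Qed.

(** [E] will be the level set of the maximal function, whose measurability is never established;
    monotonicity of the integral of nonnegative functions replaces it. The lower bound 0 serves when
    the root 1/q is taken. *)
Lemma integral_ae_subset E F w (w1 : T -> R) : measurable F ->
  measurable_fun setT w -> measurable_fun setT w1 -> (forall x, 0 < w1 x)%R ->
  {ae mu, forall x, w x = (w1 x)%:E} -> {ae mu, forall x, E x -> F x} ->
  0 <= \int[mu]_(x in E) w x <= \int[mu]_(x in F) (w1 x)%:E.
Proof.
move=> mF mw mw1 w10 ww1 EF.
have [N [mN N0 NP]] : {ae mu, forall x, w x = (w1 x)%:E /\ (E x -> F x)}.
  by apply: filterS2 ww1 EF => x.
have good x : ~ N x -> w x = (w1 x)%:E /\ (E x -> F x).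
  by move=> Nx; apply: contrapT => h; apply: Nx; exact: NP.
rewrite integral_mkcond integralE [X in _ - X](_ : _ = 0); last first.
  apply: (negligible_integral_any mN N0) => // x Nx.
  have [wx _] := good x Nx; rewrite funenegE patchE.
  by case: ifP => _; rewrite ?wx ?oppe0 ?maxxx// max_r// leeNl oppe0 lee_fin ltW.
rewrite sube0 integral_ge0//=.
have mFN : measurable (F `|` N) by exact: measurableU.
have mw1E : measurable_fun setT (fun x => (w1 x)%:E) by exact/measurable_EFinP.
have w10E x : 0 <= (w1 x)%:E by rewrite lee_fin ltW.
apply: (@le_trans _ _ (\int[mu]_x (w^\+ \_ (F `|` N)) x)).
  apply: ge0_le_integral_any => // x; rewrite funeposE !patchE.
  case: ifPn => [/set_mem Ex|_]; last by rewrite maxxx; case: ifP => // _; exact: funepos_ge0.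
  have FNx : (F `|` N) x.
    by have [Nx|/good[_ EFx]] := pselect (N x); [right|left; exact: EFx].
  by rewrite mem_set// funeposE.
rewrite -integral_mkcond.
have -> : \int[mu]_(x in F `|` N) w^\+ x = \int[mu]_(x in F `|` N) (w1 x)%:E.
  apply: integral_representative => //; first exact: measurable_funepos.
  by apply: filterS ww1 => x wx; rewrite funeposE wx max_l.
apply: le_trans (ge0_integral_setU_le mu mF mN mw1E w10E) _.
rewrite [X in _ + X](_ : _ = 0) ?adde0// integral_mkcond.
apply: (negligible_integral_any mN N0) => x; rewrite patchE; first by case: ifP.
by move=> Nx; rewrite memNset.
Qed.

Lemma integral_powR_eq0 (D : set T) (f g : T -> R) (t : R) : measurable D ->
  measurable_fun setT f -> (forall x, 0 <= f x)%R -> measurable_fun setT g ->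
  (0 < t)%R -> \int[mu]_(x in D) (f x)%:E <= 0 ->
  \int[mu]_(x in D) (f x `^ t * g x)%:E = 0.
Proof.
move=> mD mf f0 mg t0 intf.
have mfE : measurable_fun D (EFin \o f) by apply: measurable_funTS; exact/measurable_EFinP.
have fae : ae_eq mu D (EFin \o f) (cst 0).
  apply/(ae_eq_integral_abs mu mD mfE); apply/eqP; rewrite eq_le integral_ge0// andbT.
  apply: le_trans intf; rewrite le_eqVlt; apply/orP; left; apply/eqP.
  by apply: eq_integral => x _; rewrite /= ger0_norm.
rewrite -[RHS](integral0 mu D); apply: ae_eq_integral => //.
  apply: measurable_funTS; apply/measurable_EFinP.
  by apply: measurable_funM => //; exact: (measurableT_comp (measurable_powR _) mf).
apply: filterS fae => x fx Dx; have [fx0] := fx Dx.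
by rewrite fx0 powR0 ?gt_eqF// mul0r.
Qed.

End integrals_over_arbitrary_sets.

(** * Arithmetic of one cube of the fractional maximal function *)

Section fractional_reduction.
Context (R : realType).
Local Open Scope ring_scope.

(** Here l = |Q|, M = m(Q), A = G(Q), J = G(R^d), H is the integral of |f nu| over Q and w = nu(x).
    The powers of [l] cancel because a = 1/q + 1/p'; raising to the power q then produces P^q, of
    which [P0] cancels the factor from A_1 and [Pc] remains. *)
Lemma fractional_bad_cube (p q t w P P0 Pc l M A K J H a : R) :
  1 <= p -> p <= q -> 0 < t -> 0 < w -> 0 < P -> 0 < P0 -> 0 < Pc -> 0 < l -> 0 < M ->
  0 < K -> 0 <= A -> A <= J -> 0 <= H ->
  a = q^-1 + (1 - p^-1) -> P `^ q = Pc * P0 ->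
  t * w < (P * l `^ a)^-1 * H ->
  H <= ((K * P0 * l / M) `^ (p / q) * A) `^ p^-1 * l `^ (1 - p^-1) ->
  Pc * M * w `^ q < K * t `^ (- q) * J `^ (q / p - 1) * A.
Proof.
move=> p1 pq t0 w0 P_0 P00 Pc0 l0 M0 K0 A0 AJ H0 aE Pq tw HA.
have p0 : 0 < p by apply: lt_le_trans p1.
have q0 : 0 < q by apply: lt_le_trans pq.
have B0 : 0 < K * P0 / M by rewrite divr_gt0// mulr_gt0.
have la : 0 < l `^ (1 - p^-1) by rewrite powR_gt0.
have lq : 0 < l `^ q^-1 by rewrite powR_gt0.
have HA' : H <= (K * P0 / M) `^ q^-1 * A `^ p^-1 * l `^ q^-1 * l `^ (1 - p^-1).
  apply: le_trans HA _; rewrite ler_pM2r//.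
  have -> : K * P0 * l / M = K * P0 / M * l by field; rewrite gt_eqF.
  rewrite powRM ?powR_ge0// -powRrM.
  have -> : p / q * p^-1 = q^-1 by field; rewrite !gt_eqF.
  rewrite powRM ?(ltW B0) ?(ltW l0)// le_eqVlt; apply/orP; left; apply/eqP; ring.
have tw' : t * w * P < (K * P0 / M) `^ q^-1 * A `^ p^-1.
  move: tw; rewrite aE powRD; last by rewrite (gt_eqF l0) implybT.
  rewrite ltr_pdivlMl ?mulr_gt0// => h.
  have := lt_le_trans h HA'; rewrite -(mulrA _ (l `^ q^-1)).
  have -> : P * (l `^ q^-1 * l `^ (1 - p^-1)) * (t * w) =
    t * w * P * (l `^ q^-1 * l `^ (1 - p^-1)) by ring.
  by rewrite ltr_pM2r// mulr_gt0.
have := gt0_ltr_powR q0 _ _ tw'; rewrite !nnegrE !mulr_ge0 ?powR_ge0 1?ltW// => /(_ isT isT).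
have -> : (t * w * P) `^ q = t `^ q * (Pc * P0 * w `^ q).
  by rewrite !powRM ?mulr_ge0 1?ltW// Pq; ring.
have -> : ((K * P0 / M) `^ q^-1 * A `^ p^-1) `^ q = K * P0 / M * A `^ (q / p).
  rewrite powRM ?powR_ge0// -!powRrM mulVf ?gt_eqF// powRr1 ?(ltW B0)//.
  by rewrite (mulrC p^-1).
move=> h.
have {}h : Pc * M * w `^ q < K * t `^ (- q) * A `^ (q / p).
  rewrite powRN -(ltr_pM2l (mulr_gt0 (powR_gt0 q t0) P00)).
  have tq : 0 < t `^ q by rewrite powR_gt0.
  have -> : t `^ q * P0 * (Pc * M * w `^ q) = t `^ q * (Pc * P0 * w `^ q) * M by ring.
  have -> : t `^ q * P0 * (K * (t `^ q)^-1 * A `^ (q / p)) = K * P0 / M * A `^ (q / p) * M.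
    by field; rewrite !gt_eqF.
  by rewrite ltr_pM2r.
apply: lt_le_trans h _; rewrite -!mulrA ler_pM2l// ler_pM2l ?powR_gt0//.
rewrite -(@mulr_powRB1 _ A) ?divr_gt0// mulrC; apply: ler_wpM2r => //.
apply: ge0_ler_powR; rewrite ?nnegrE//; last exact: le_trans AJ.
by rewrite subr_ge0 ler_pdivlMr// mul1r.
Qed.

End fractional_reduction.

(** * Null cubes, and doubling of A_1 weights *)

Section lebesgue_null.
Context (R : realType) (d : nat).
Local Notation V := 'rV[R]_d.

(** The integer dilates of one cube exhaust the space, and each is null by scaling. *)
Lemma leb_null_cube (c : V) (r : R) : (0 < r)%R -> leb (cube c r) = 0 -> leb [set: V] = 0.
Proof.
move=> r0 Q0.
have mQ n : measurable (cube c (n.+1%:R * r)%R) by exact: measurable_cube.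
have nQ n : leb (cube c (n.+1%:R * r)%R) = 0.
  apply/eqP; rewrite eq_le measure_ge0 andbT.
  by apply: le_trans (leb_cube_scale c r (ltr0Sn R n)) _; rewrite Q0 mule0.
have cover : [set: V] = \bigcup_n cube c (n.+1%:R * r)%R.
  apply/seteqP; split => // x _.
  pose S : R := (\sum_(i < d) `|x ord0 i - c ord0 i|)%R.
  exists (Num.truncn (2 * S / r)) => // i.
  have xS : (`|x ord0 i - c ord0 i| <= S)%R.
    by rewrite /S (bigD1 i)//= lerDl; apply: sumr_ge0.
  apply: le_trans xS _; rewrite ler_pdivlMr// mulrC -ler_pdivrMr//.
  exact: ltW (truncnS_gt _).
apply/eqP; rewrite eq_le measure_ge0 andbT cover.
apply: le_trans (measure_sigma_subadditive leb mQ (bigcup_measurable (fun n _ => mQ n)) (@subset_refl _ _)) _.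
by rewrite eseries0.
Qed.

Lemma integral_null (f : V -> \bar R) (E : set V) : leb [set: V] = 0 ->
  \int[leb]_(x in E) f x = 0.
Proof.
move=> T0; rewrite integral_mkcond integralE.
have null (g : V -> \bar R) : (forall x, 0 <= g x) -> \int[leb]_x g x = 0.
  move=> g0; have gT x : ~ [set: V] x -> g x = 0 by move=> /(_ Logic.I).
  have := @negligible_integral_any _ V R leb [set: V] g measurableT T0 g0 gT.
  exact.
by rewrite null// null// sube0.
Qed.

Lemma psi_le (rho : V -> R) (th th' : R) c r : (0 < rho c)%R -> (0 < r)%R ->
  (th <= th')%R -> (psi rho th c r <= psi rho th' c r)%R.
Proof.
by move=> rho0 r0 h; rewrite /psi ler_powR// lerDl divr_ge0// ltW.
Qed.

(** The pointwise A_1 bound of the cube 5Q is integrated over Q only. The factors 5^theta and 5^d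
    come from psi and from the volume of 5Q. *)
Lemma A1_doubling (rho m : V -> R) (K theta : R) :
  (forall x, 0 < rho x)%R -> (forall c r, (0 < r)%R -> 0 < leb (cube c r : set V)) ->
  (0 < K)%R -> (0 <= theta)%R -> measurable_fun setT m -> (forall x, 0 < m x)%R ->
  (forall c r, (0 < r)%R ->
    [/\ \int[leb]_(x in cube c r) (m x)%:E = (mass leb m (cube c r))%:E,
      (0 < mass leb m (cube c r))%R &
      {ae leb, forall x, cube c r x ->
        mass leb m (cube c r) <= K * psi rho theta c r * fine (leb (cube c r : set V)) * m x}%R]) ->
  forall c r, (0 < r)%R -> (mass leb m (cube c (5 * r)) <=
    K * 5 `^ theta * 5 ^+ d * psi rho theta c r * mass leb m (cube c r))%R.
Proof.
move=> rho0 leb0 K0 th0 mm m0 A1 c r r0.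
have r50 : (0 < 5 * r)%R by rewrite mulr_gt0.
have [m5 M5 ae5] := A1 c _ r50; have [mi M0 _] := A1 c r r0.
have mQ := measurable_cube c r.
set l5 := fine _ in ae5; set l := fine (leb (cube c r)).
have lE : leb (cube c r) = l%:E by rewrite fineK// ge0_fin_numE// leb_cube_lty.
have l5E : leb (cube c (5 * r)%R) = l5%:E by rewrite fineK// ge0_fin_numE// leb_cube_lty.
have l0 : (0 < l)%R by rewrite -lte_fin -lE leb0.
have l50 : (0 < l5)%R by rewrite -lte_fin -l5E leb0.
have l5l : (l5 <= 5 ^+ d * l)%R.
  by rewrite -lee_fin -l5E EFinM -lE; exact: leb_cube_scale.
set k5 := (K * psi rho theta c (5 * r) * l5)%R in ae5.
have p50 : (0 < psi rho theta c (5 * r))%R by apply: lt_le_trans (psi_ge1 (rho0 c) th0 r50).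
have k50 : (0 < k5)%R by rewrite !mulr_gt0.
have key : (mass leb m (cube c (5 * r)) * l <= k5 * mass leb m (cube c r))%R.
  rewrite -lee_fin (EFinM k5) -mi EFinM -lE -(integral_cst leb mQ).
  rewrite -(ge0_integralZl_EFin leb mQ _ _ (ltW k50)); last 2 first.
  - by move=> x _; rewrite lee_fin ltW.
  - by apply: measurable_funTS; exact/measurable_EFinP.
  apply: (ae_ge0_le_integral mQ).
  - by move=> x _; rewrite lee_fin ltW.
  - exact: measurable_cst.
  - by move=> x _; rewrite -EFinM lee_fin mulr_ge0 ?(ltW k50) ?(ltW (m0 x)).
  - apply: measurable_funTS.
    by apply: (measurable_EFinP _ (fun x => k5 * m x)%R).2; exact: measurable_funM.
  apply: filterS ae5 => x h Qx; rewrite -EFinM lee_fin; apply: h.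
  by apply: subset_cube_concentric Qx; rewrite ler_peMl ?ler1n// ltW.
rewrite -(ler_pM2r l0); apply: le_trans key _.
rewrite [leRHS]mulrAC ler_pM2r// /k5.
apply: (@le_trans _ _ (K * (5 `^ theta * psi rho theta c r) * (5 ^+ d * l))%R).
  apply: ler_pM => //; [by rewrite mulr_ge0// ltW|exact: ltW|].
  by rewrite ler_pM2l//; exact: psi_dilate.
by rewrite le_eqVlt; apply/orP; left; apply/eqP; ring.
Qed.

End lebesgue_null.

(** * From the level set to a cube satisfying the abstract condition *)

Section fractional_maximal_function.
Context (R : realType) (d : nat).
Local Notation V := 'rV[R]_d.

(** The exponent (thc + th1) / q is chosen so that the q-th power of psi splits into psi with
    exponent [thc], kept for the conclusion, and psi with exponent [th1], spent on the A_1 bound. *)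
Lemma frac_maximal_bad_cube (alpha p q t J thc th1 K1 : R) (rho : V -> R)
    (nu : V -> \bar R) (n1 m f : V -> R) (x : V) :
  (1 <= p)%R -> (p <= q)%R -> (1 - alpha / d%:R = q^-1 + (1 - p^-1))%R ->
  (0 < t)%R -> (0 < K1)%R -> (forall x, 0 < rho x)%R ->
  (forall c r, (0 < r)%R -> 0 < leb (cube c r : set V)) ->
  measurable_fun setT nu -> measurable_fun setT n1 -> (forall x, 0 < n1 x)%R ->
  {ae leb, forall x, nu x = (n1 x)%:E} ->
  measurable_fun setT m -> (forall x, 0 < m x)%R ->
  (forall c r, (0 < r)%R ->
    [/\ \int[leb]_(x in cube c r) (m x)%:E = (mass leb m (cube c r))%:E,
      (0 < mass leb m (cube c r))%R &
      {ae leb, forall x, cube c r x ->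
        mass leb m (cube c r) <= K1 * psi rho th1 c r * fine (leb (cube c r : set V)) * m x}%R]) ->
  measurable_fun setT f ->
  let G y := ((`|f y| * n1 y) `^ p * m y `^ (p / q))%R in
  \int[leb]_y (G y)%:E = J%:E ->
  nu x = (n1 x)%:E ->
  t%:E < frac_maximal rho ((thc + th1) / q) alpha (fun y => (f y)%:E * nu y) x / nu x ->
  exists c r, [/\ (0 < r)%R, cube c r x &
    (psi rho thc c r * mass leb m (cube c r) * n1 x `^ q <
      mass leb (fun y => K1 * t `^ (- q) * J `^ (q / p - 1) * G y) (cube c r))%R].
Proof.
move=> p1 pq aE t0 K10 rho0 leb0 mnu mn1 n10 nun1 mm m0 A1 mf G GJ nux.
have p0 : (0 < p)%R by apply: lt_le_trans p1.
have q0 : (0 < q)%R by apply: lt_le_trans pq.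
pose h (y : V) : R := (`|f y| * n1 y)%R.
have mnf : measurable_fun setT (fun y => `|f y|)%R by exact: (measurableT_comp (@normr_measurable R _) mf).
have mh : measurable_fun setT h by exact: measurable_funM mnf mn1.
have h0 y : (0 <= h y)%R by rewrite mulr_ge0// ltW.
have mhp : measurable_fun setT (fun y => h y `^ p)%R.
  exact: (measurableT_comp (measurable_powR _) mh).
have mG : measurable_fun setT G.
  exact: (measurable_funM mhp (measurableT_comp (measurable_powR _) mm)).
have G0 y : (0 <= G y)%R by rewrite mulr_ge0 ?powR_ge0.
rewrite nux inver gt_eqF// lte_pdivlMr// -EFinM => /ereal_sup_gt[_ [c [r [r0 Qx ->]]]].
rewrite leb_cubeE -poweR_EFin -EFinM => bad.
exists c, r; split; [exact: r0|exact: Qx|].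
have mQ := measurable_cube c r.
have [mi M0 ae5] := A1 c r r0; have lE := leb_cubeE c r.
set l := fine (leb (cube c r : set V)) in ae5 lE bad.
set M := mass leb m (cube c r) in M0 ae5 mi *.
have l0 : (0 < l)%R by rewrite -lte_fin -lE leb0.
have P00 : (0 < psi rho th1 c r)%R by rewrite powR_gt0// addr_gt0// divr_gt0.
have mhE : measurable_fun (cube c r) (EFin \o h).
  by apply: measurable_funTS; exact/measurable_EFinP.
have mGE : measurable_fun setT (EFin \o G) by exact/measurable_EFinP.
have mfnu : measurable_fun setT (fun y => (f y)%:E * nu y).
  by apply: emeasurable_funM mnu; exact/measurable_EFinP.
have intQ : \int[leb]_(y in cube c r) `|(f y)%:E * nu y| = \int[leb]_(y in cube c r) (h y)%:E.
  apply: (integral_representative mQ _ mh).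
    exact: (measurableT_comp (@abse_measurable R setT) mfnu).
  apply: filterS nun1 => y ->; rewrite -EFinM abse_EFin normrM.
  by rewrite (gtr0_norm (n10 y)).
rewrite {}intQ in bad.
pose A := mass leb G (cube c r).
have AJ' : \int[leb]_(y in cube c r) (G y)%:E <= J%:E.
  rewrite -GJ; apply: (ge0_subset_integral leb mQ measurableT mGE) => //.
  by move=> y _; rewrite lee_fin.
have AE : \int[leb]_(y in cube c r) (G y)%:E = A%:E.
  by apply: massE => //; apply: le_lt_trans AJ' _; exact: ltry.
have AJ : (A <= J)%R by rewrite -lee_fin -AE.
have A0 : (0 <= A)%R by rewrite -lee_fin -AE integral_ge0// => y _; rewrite lee_fin.
(* By A_1 the product of the base of [B] with [m] is at least 1 a.e. on the cube; its power p/q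
   inserts the weight m^(p/q) into |f nu|^p at the cost of [B]. *)
pose B : R := ((K1 * psi rho th1 c r * l / M) `^ (p / q))%R.
have B0 : (0 < B)%R by rewrite powR_gt0// divr_gt0// !mulr_gt0.
have hpA : \int[leb]_(y in cube c r) (h y `^ p)%:E <= (B * A)%:E.
  rewrite EFinM -AE -(ge0_integralZl_EFin leb mQ _ _ (ltW B0)); last 2 first.
  - by move=> y _; rewrite lee_fin.
  - exact: measurable_funTS mGE.
  apply: (ae_ge0_le_integral mQ).
  - by move=> y _; rewrite lee_fin powR_ge0.
  - by apply: measurable_funTS; exact/measurable_EFinP.
  - by move=> y _; rewrite -EFinM lee_fin mulr_ge0 ?(ltW B0).
  - apply: measurable_funTS.
    by apply: (measurable_EFinP _ (fun y => B * G y)%R).2; exact: measurable_funM.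
  apply: filterS ae5 => y /[apply] My; rewrite -EFinM lee_fin /G -/(h y).
  rewrite mulrCA ler_peMr ?powR_ge0// /B -powRM ?(ltW (m0 y))//; last first.
    by rewrite divr_ge0 ?mulr_ge0 ?ltW.
  apply: powR_ge1; last by rewrite divr_ge0 ?ltW.
  by rewrite mulrAC ler_pdivlMr// mul1r.
have HA : \int[leb]_(y in cube c r) (h y)%:E <= ((B * A) `^ p^-1 * l `^ (1 - p^-1))%:E.
  have hE y : h y = ((h y `^ p) `^ p^-1)%R by rewrite -powRrM divff ?powRr1// gt_eqF.
  have p'1 : (0 <= p^-1 <= 1)%R by rewrite invr_ge0 (ltW p0) invf_le1.
  (* Hoelder's inequality in normalized form excludes a zero bound; in that case f nu vanishes a.e.
     on the cube. *)
  have [A_eq0|A_neq0] := eqVneq A 0%R.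
    rewrite (_ : \int[leb]_(y in cube c r) (h y)%:E = 0); last first.
      transitivity (\int[leb]_(y in cube c r) ((h y `^ p) `^ p^-1 * 1)%:E).
        by apply: eq_integral => y _; rewrite mulr1 -hE.
      apply: (integral_powR_eq0 mQ mhp) => //.
      - by move=> y; exact: powR_ge0.
      - by rewrite invr_gt0.
      - by apply: le_trans hpA _; rewrite A_eq0 mulr0.
    by rewrite lee_fin mulr_ge0 ?powR_ge0.
  have BA0 : (0 < B * A)%R by rewrite mulr_gt0// lt_neqAle eq_sym A_neq0.
  have int1 : \int[leb]_(y in cube c r) (1%R)%:E <= l%:E by rewrite integral_cst// mul1e lE.
  rewrite (_ : \int[leb]_(y in cube c r) (h y)%:E =
      \int[leb]_(y in cube c r) ((h y `^ p) `^ p^-1 * 1 `^ (1 - p^-1))%:E); last first.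
    by apply: eq_integral => y _; rewrite powR1 mulr1 -hE.
  have one0 (y : V) : (0 <= 1 :> R)%R by [].
  have hp0 y : (0 <= h y `^ p)%R by exact: powR_ge0.
  have m_one : measurable_fun setT (fun _ : V => 1%R : R) by exact: measurable_cst.
  exact: (integral_powR_le mQ mhp hp0 m_one one0 BA0 hpA l0 int1 p'1).
have HE : \int[leb]_(y in cube c r) (h y)%:E = (mass leb h (cube c r))%:E.
  by apply: massE => //; apply: le_lt_trans HA _; exact: ltry.
rewrite HE lee_fin in HA.
have H0 : (0 <= mass leb h (cube c r))%R.
  by rewrite -lee_fin -HE integral_ge0// => y _; rewrite lee_fin.
have Pq : (psi rho ((thc + th1) / q) c r `^ q = psi rho thc c r * psi rho th1 c r)%R.
  have b0 : (0 < 1 + r / rho c)%R by rewrite addr_gt0// divr_gt0.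
  by rewrite psi_powR divfK ?gt_eqF// /psi powRD// (gt_eqF b0) implybT.
rewrite (_ : mass leb _ _ = K1 * t `^ (- q) * J `^ (q / p - 1) * A)%R; last first.
  rewrite /mass -/(mass leb G (cube c r)); under eq_integral do rewrite EFinM.
  rewrite (ge0_integralZl_EFin leb mQ) ?AE//.
  - by move=> y _; rewrite lee_fin.
  - exact: measurable_funTS mGE.
  - by rewrite !mulr_ge0 ?powR_ge0// ltW.
have psi_pos th : (0 < psi rho th c r)%R by rewrite powR_gt0// addr_gt0// divr_gt0.
have la0 t' : (0 < l `^ t')%R by exact: powR_gt0.
have bad' : (t * n1 x < (psi rho ((thc + th1) / q) c r * l `^ (1 - alpha / d%:R))^-1 *
    mass leb h (cube c r))%R.
  move: bad; rewrite HE inver gt_eqF; last exact: mulr_gt0 (psi_pos _) (la0 _).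
  by rewrite -EFinM lte_fin.
exact: (fractional_bad_cube p1 pq t0 (n10 x) (psi_pos _) P00 (psi_pos _) l0 M0 K10 A0 AJ H0
  aE Pq bad' HA).
Qed.

End fractional_maximal_function.

(** * Assembly when all cubes have positive measure *)

Section nondegenerate_case.
Context (R : realType) (d : nat).
Local Notation V := 'rV[R]_d.

Lemma mixed_weak_type_nondegenerate (alpha p q : R) (rho : V -> R) (mu nu : V -> \bar R) :
  (1 <= p)%R -> (p <= q)%R -> (1 - alpha / d%:R = q^-1 + (1 - p^-1))%R ->
  (forall x, 0 < rho x)%R ->
  (forall c r, (0 < r)%R -> 0 < leb (cube c r : set V)) ->
  weight mu -> weight nu ->
  A_class rho (fun=> 1) 1%R (fun x => mu x * nu x `^ (- div_conj q p)%R) ->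
  A_infty rho (fun x => mu x * nu x `^ (- div_conj q p)%R) (fun x => nu x `^ q) ->
  exists theta C : R, [/\ (0 <= theta)%R, (0 < C)%R &
    forall (t : R) (f : V -> R), (0 < t)%R -> measurable_fun setT f ->
      wmeasure (fun x => mu x * nu x `^ (q / p)%R)
        [set x | t%:E <
           frac_maximal rho theta alpha (fun y => (f y)%:E * nu y) x / nu x]
        `^ (q^-1)%R
      <= (C / t)%:E *
         (\int[leb]_x (((`|f x| `^ p)%R)%:E * mu x `^ (p / q)%R * nu x))
           `^ (p^-1)%R].
Proof.
move=> p1 pq aE rho0 leb0 [mmu _ mu_ae] [mnu _ nu_ae].
set dc := div_conj q p => hA1 hAinf.
have p0 : (0 < p)%R by apply: lt_le_trans p1.
have q0 : (0 < q)%R by apply: lt_le_trans pq.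
have dcE : dc = (q - q / p)%R by exact: div_conjE.
have [m1 [mm1 m10 mum1]] := positive_representative mmu mu_ae.
have [n1 [mn1 n10 nun1]] := positive_representative mnu nu_ae.
have mn1t t : measurable_fun setT (fun x => n1 x `^ t)%R.
  exact: (measurableT_comp (measurable_powR _) mn1).
have mnut t : measurable_fun setT (fun x => nu x `^ t).
  exact: (measurableT_comp (measurable_poweR _) mnu).
pose m (x : V) : R := (m1 x * n1 x `^ (- dc))%R.
pose v (x : V) : R := (n1 x `^ q)%R.
have m0 x : (0 < m x)%R by rewrite mulr_gt0// powR_gt0.
have v0 x : (0 < v x)%R by exact: powR_gt0.
have mm : measurable_fun setT m by exact: measurable_funM mm1 (mn1t _).
have mv : measurable_fun setT v by exact: mn1t.
have mmu0 : measurable_fun setT (fun x => mu x * nu x `^ (- dc)).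
  exact: emeasurable_funM mmu (mnut _).
have mu0m : {ae leb, forall x, mu x * nu x `^ (- dc) = (m x)%:E}.
  by apply: filterS2 mum1 nun1 => x -> ->.
have nuv : {ae leb, forall x, nu x `^ q = (v x)%:E}.
  by apply: filterS nun1 => x ->.
have [K1 [th1 [K10 th10 A1]]] := A1_cubes rho0 leb0 mmu0 mm m0 mu0m hA1.
have mpos c r : (0 < r)%R ->
    \int[leb]_(x in cube c r) (m x)%:E = (mass leb m (cube c r))%:E /\
    (0 < mass leb m (cube c r))%R.
  by move=> r0; have [] := A1 c r r0.
have [s [K2 [k2 [s1 K20 k20 Ainf]]]] :=
  A_infty_cubes rho0 leb0 mmu0 mm m0 mu0m (mnut q) mv v0 nuv mpos hAinf.
pose vm (x : V) : R := (v x * m x)%R.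
pose wm (x : V) : R := (v x `^ (- (s - 1)^-1) * m x)%R.
have mdbl := A1_doubling rho0 leb0 K10 th10 mm m0 A1.
set K1' := (K1 * _ * _)%R in mdbl.
pose K : R := Num.max 1%R (Num.max K1' K2).
pose k := Num.max th1 k2.
have K_ge1 : (1 <= K)%R by rewrite le_max lexx.
have k0 : (0 <= k)%R by rewrite le_max th10.
have Kpsi K' k' c r : (0 < r)%R -> (K' <= K)%R -> (k' <= k)%R ->
    (K' * psi rho k' c r <= K * psi rho k c r)%R.
  move=> r0 K'K k'k; apply: (@le_trans _ _ (K * psi rho k' c r)%R).
    by apply: ler_wpM2r K'K; exact: powR_ge0.
  apply: ler_wpM2l; first exact: le_trans K_ge1.
  exact: psi_le.
have mdbl' c r : (0 < r)%R ->
    (mass leb m (cube c (5 * r)) <= K * psi rho k c r * mass leb m (cube c r))%R.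
  move=> r0; apply: le_trans (mdbl c r r0) _; apply: ler_wpM2r.
    by have [_ /ltW] := mpos c r r0.
  by apply: Kpsi => //; rewrite /K /k !le_max lexx ?orbT.
have Ap c r : (0 < r)%R -> (mass leb vm (cube c r) * mass leb wm (cube c r) `^ (s - 1) <=
      K * psi rho k c r * mass leb m (cube c r) `^ s)%R.
  move=> r0; have [_ _ h] := Ainf c r r0; apply: le_trans h _; apply: ler_wpM2r.
    exact: powR_ge0.
  by apply: Kpsi => //; rewrite /K /k !le_max lexx ?orbT.
have vmpos c r : (0 < r)%R ->
    \int[leb]_(x in cube c r) (vm x)%:E = (mass leb vm (cube c r))%:E /\
    (0 < mass leb vm (cube c r))%R by move=> r0; have [h _ _] := Ainf c r r0; exact: h.
have wmpos c r : (0 < r)%R ->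
    \int[leb]_(x in cube c r) (wm x)%:E = (mass leb wm (cube c r))%:E /\
    (0 < mass leb wm (cube c r))%R by move=> r0; have [_ h _] := Ainf c r r0; exact: h.
have [thc [Cc [thc0 Cc0 core]]] := mixed_weak_type_cubes rho0 s1 K_ge1 k0 mm m0 mv v0
  (fun x : V => erefl (vm x)) (fun x : V => erefl (wm x)) mpos vmpos wmpos mdbl' Ap.
have CK : (0 < Cc * K1)%R by rewrite mulr_gt0.
exists ((thc + th1) / q)%R, ((Cc * K1) `^ q^-1)%R; split.
- by rewrite divr_ge0 ?addr_ge0// ltW.
- exact: powR_gt0.
move=> t f t0 mf.
pose h (y : V) : R := (`|f y| * n1 y)%R.
have mnf : measurable_fun setT (fun y => `|f y|)%R by exact: (measurableT_comp (@normr_measurable R _)).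
have mh : measurable_fun setT h by exact: measurable_funM.
have h0 y : (0 <= h y)%R by rewrite mulr_ge0// ltW.
pose G0 (y : V) : R := (h y `^ p * m y `^ (p / q))%R.
have G00 y : (0 <= G0 y)%R by rewrite mulr_ge0 ?powR_ge0.
have mG0 : measurable_fun setT G0.
  exact: (measurable_funM (measurableT_comp (measurable_powR _) mh)
    (measurableT_comp (measurable_powR _) mm)).
(* The powers of nu combine to p - (q/p')(p/q) = 1, so [G0] is exactly the density on the right-hand
   side of the theorem. *)
have G0E y : (G0 y = `|f y| `^ p * m1 y `^ (p / q) * n1 y)%R.
  rewrite /G0 /h /m.
  rewrite !powRM ?powR_ge0 ?(ltW (n10 y)) ?(ltW (m10 y))//.
  rewrite -powRrM -!mulrA; congr (_ * _)%R; rewrite mulrCA; congr (_ * _)%R.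
  rewrite -powRD ?(gt_eqF (n10 y)) ?implybT//.
  have -> : (p + - dc * (p / q) = 1)%R by rewrite dcE; field; rewrite !gt_eqF.
  by rewrite powRr1// ltW.
have -> : \int[leb]_x (((`|f x| `^ p)%R)%:E * mu x `^ (p / q)%R * nu x) =
    \int[leb]_x (G0 x)%:E.
  have mnfp : measurable_fun setT (fun x => (`|f x| `^ p)%:E).
    by apply/measurable_EFinP; exact: (measurableT_comp (measurable_powR _) mnf).
  have mmup : measurable_fun setT (fun x => mu x `^ (p / q)).
    exact: (measurableT_comp (measurable_poweR _) mmu).
  apply: (integral_representative measurableT
    (emeasurable_funM (emeasurable_funM mnfp mmup) mnu) mG0).
  by apply: filterS2 mum1 nun1 => x -> ->; rewrite G0E.
have Ct0 : (0 < (Cc * K1) `^ q^-1 / t)%R by rewrite divr_gt0// powR_gt0.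
have : 0 <= \int[leb]_x (G0 x)%:E by apply: integral_ge0 => x _; rewrite lee_fin.
case J_eq : (\int[leb]_x (G0 x)%:E) => [J| |]// J0; last first.
  by rewrite poweRyr ?gt0_muley ?leey ?lte_fin// gt_eqF// invr_gt0.
rewrite lee_fin in J0.
(* The factor found in [frac_maximal_bad_cube]. Its power of [J] raises the total mass to J^(q/p),
   whose q-th root is J^(1/p). *)
pose b : R := (K1 * t `^ (- q) * J `^ (q / p - 1))%R.
have b0 : (0 <= b)%R by rewrite !mulr_ge0 ?powR_ge0// ltW.
pose g (y : V) : R := (b * G0 y)%R.
have g0 y : (0 <= g y)%R by rewrite mulr_ge0.
have mg : measurable_fun setT g by exact: measurable_funM (measurable_cst b) mG0.
have mG0E : measurable_fun setT (fun y => (G0 y)%:E) by exact/measurable_EFinP.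
have G00E y : 0 <= (G0 y)%:E by rewrite lee_fin.
have intg (D : set V) : measurable D ->
    \int[leb]_(y in D) (g y)%:E = b%:E * \int[leb]_(y in D) (G0 y)%:E.
  move=> mD; have mG0D : measurable_fun D (fun y => (G0 y)%:E).
    exact: measurable_funTS mG0E.
  by rewrite -(ge0_integralZl_EFin leb mD (fun y _ => G00E y) mG0D b0).
have gE : \int[leb]_y (g y)%:E = (b * J)%:E by rewrite intg// J_eq.
have [F [mF FC FP]] := core g mg g0 (eq_ind_r (fun z => z < +oo) (ltry _) gE).
have mvm : measurable_fun setT vm by exact: measurable_funM mv mm.
have vm0 x : (0 < vm x)%R by exact: mulr_gt0.
have /andP[E0 EF] : 0 <= wmeasure (fun x => mu x * nu x `^ (q / p)%R)
    [set x | t%:E < frac_maximal rho ((thc + th1) / q) alpha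
      (fun y => (f y)%:E * nu y) x / nu x] <= \int[leb]_(x in F) (vm x)%:E.
  apply: (integral_ae_subset mF (emeasurable_funM mmu (mnut _)) mvm vm0).
  (* Since q - q/p' = q/p, [vm] represents mu nu^(q/p). *)
  - apply: filterS2 mum1 nun1 => x -> ->; rewrite -EFinM; congr EFin.
    rewrite /vm /v /m mulrCA -powRD ?(gt_eqF (n10 x)) ?implybT//.
    by congr (_ * _ `^ _)%R; rewrite dcE; ring.
  apply: filterS (nun1) => x nux bad.
  have [c [r [r0 Qx h_bad]]] := frac_maximal_bad_cube p1 pq aE t0 K10 rho0 leb0
    mnu mn1 n10 nun1 mm m0 A1 mf J_eq nux bad.
  exact: (FP x c r r0 Qx h_bad).
set X := wmeasure _ _ in E0 EF *.
have XJ : X <= (Cc * (b * J))%:E.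
  by apply: le_trans EF _; apply: le_trans FC _; rewrite gE -EFinM.
have qV0 : (0 <= q^-1)%R by rewrite invr_ge0 ltW.
have bJ : (b * J = K1 * t `^ (- q) * J `^ (q / p))%R.
  by rewrite /b -mulrA (mulrC _ J) mulr_powRB1// divr_gt0.
have CbJ0 : (0 <= Cc * (b * J))%R by rewrite mulr_ge0 ?(ltW Cc0)// mulr_ge0.
have := gt0_ler_poweR qV0 _ _ XJ.
rewrite !in_itv/= E0 lee_fin CbJ0 !leey => /(_ isT isT) /le_trans; apply.
rewrite lee_fin bJ le_eqVlt; apply/orP; left; apply/eqP.
have -> : (Cc * (K1 * t `^ (- q) * J `^ (q / p)) =
    Cc * K1 * (t `^ (- q) * J `^ (q / p)))%R by ring.
rewrite (@powRM _ (Cc * K1)%R) ?(ltW CK) ?mulr_ge0 ?powR_ge0//.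
rewrite (@powRM _ (t `^ (- q))%R) ?powR_ge0// -!powRrM mulNr divff ?(gt_eqF q0)//.
rewrite powR_inv1 ?(ltW t0)//.
have -> : (q / p * q^-1 = p^-1)%R by field; rewrite !gt_eqF.
by rewrite mulrA.
Qed.

End nondegenerate_case.

Unset Implicit Arguments.

Theorem theorem1p6 (R : realType) (d : nat) (hd : (3 <= d)%N)
  (alpha p q : R)
  (halpha : (0 <= alpha < d%:R)%R)
  (hp1 : (1 <= p)%R) (hp : p%:E < (d%:R)%:E / alpha%:E)
  (hq : (q^-1 = p^-1 - alpha / d%:R)%R)
  (rho : 'rV[R]_d -> R) (hrho : critical_radius rho)
  (mu nu : 'rV[R]_d -> \bar R) (hmu : weight mu) (hnu : weight nu)
  (hA1 : A_class rho (fun=> 1) 1%R (fun x => mu x * nu x `^ (- div_conj q p)%R))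
  (hAinfty : A_infty rho (fun x => mu x * nu x `^ (- div_conj q p)%R)
                         (fun x => nu x `^ q)) :
  exists theta C : R, [/\ (0 <= theta)%R, (0 < C)%R &
    forall (t : R) (f : 'rV[R]_d -> R), (0 < t)%R -> Linfty_c f ->
      wmeasure (fun x => mu x * nu x `^ (q / p)%R)
        [set x | t%:E <
           frac_maximal rho theta alpha (fun y => (f y)%:E * nu y) x / nu x]
        `^ (q^-1)%R
      <= (C / t)%:E *
         (\int[leb]_x (((`|f x| `^ p)%R)%:E * mu x `^ (p / q)%R * nu x))
           `^ (p^-1)%R].
Proof.
have [rho0 _] := hrho; have /andP[alpha0 alphad] := halpha.
have d0 : (0 < d%:R :> R)%R by rewrite ltr0n; apply: leq_trans hd.
have p0 : (0 < p)%R by apply: lt_le_trans hp1.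
(* This is p < d/alpha; alpha = 0 is separate because d/alpha is then +oo. *)
have qV0 : (0 < q^-1)%R.
  rewrite hq subr_gt0; move: alpha0; rewrite le_eqVlt => /predU1P[<-|a0].
    by rewrite mul0r invr_gt0.
  move: hp; rewrite inver gt_eqF// -EFinM lte_fin => pda.
  by rewrite -[ltLHS]invrK ltf_pV2 ?posrE ?invr_gt0 ?divr_gt0// invf_div.
have q0 : (0 < q)%R by rewrite -invr_gt0.
have pq : (p <= q)%R.
  by rewrite -(@lef_pV2 _ q p) ?posrE// hq gerBl divr_ge0// ltW.
have aE : (1 - alpha / d%:R = q^-1 + (1 - p^-1))%R by rewrite hq; ring.
have [leb0|/existsNP[c /existsNP[r /not_implyP[r0 /negP]]]] :=
    pselect (forall c r, (0 < r)%R -> 0 < leb (cube c r : set 'rV[R]_d)).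
  have [theta [C [th0 C0 main]]] :=
    mixed_weak_type_nondegenerate hp1 pq aE rho0 leb0 hmu hnu hA1 hAinfty.
  exists theta, C; split => // t f t0 [mf _ _].
  exact: main.
(* That cubes have positive measure is not needed: if one is null, then so is
   the whole space, and the left-hand side vanishes. *)
rewrite -leNgt => Q0.
have lebT0 : leb [set: 'rV[R]_d] = 0.
  by apply: (leb_null_cube r0); apply/eqP; rewrite eq_le measure_ge0 andbT; exact: Q0.
exists 0%R, 1%R; split => // t f t0 _.
rewrite /wmeasure integral_null// poweR0r ?gt_eqF// mule_ge0 ?poweR_ge0//.
by rewrite lee_fin divr_ge0// ltW.
Qed.
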